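(* Let $0<\alpha<1$, $1<p<\infty$, $T>0$, and let $\omega\in A_p$ be a Muckenhoupt weight on $(0,T)$. Then there exists a constant $C>0$ such that for every $y\in W^{2,p}_\omega(0,T)$, every integer $N\ge 1$ with step size $\tau=T/N$ and grid $t_n=n\tau$, and every $1\le n\le N$, $$|D^\alpha y(t_n)-\delta_\tau^\alpha y(t_n)|\le C\,\tau^{2-\alpha-1/p}\,\Lambda(\omega,\tau)\,\|y\|_{W^{2,p}_\omega},$$ where $$\Lambda(\omega,\tau)=\sup_{0\le j\le N-1}\tau^{-1/q}W_j=\sup_{0\le j\le N-1}\left(\frac1\tau\int_{t_j}^{t_{j+1}}\omega(s)^{-\frac{1}{p-1}}\,ds\right)^{\frac{p-1}{p}},\qquad W_j:=\|\omega^{-1/p}\|_{L^q(t_j,t_{j+1})},\quad \frac1p+\frac1q=1.$$ In particular $C$ does not depend on $\tau$, $n$ or $y$.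
   Context: A weight is a locally integrable function $\omega:(0,T)\to[0,\infty)$. The weighted space $L^p_\omega(0,T)$ has norm $\|y\|_{L^p_\omega}=\left(\int_0^T|y(t)|^p\omega(t)\,dt\right)^{1/p}$. The weighted Sobolev space is $W^{s,p}_\omega(0,T)=\{y\in L^p_\omega(0,T): y',\dots,y^{(s)}\in L^p_\omega(0,T)\}$ (weak derivatives) with norm $\|y\|_{W^{s,p}_\omega}=\left(\int_0^T\left(\sum_{k=0}^s|y^{(k)}(t)|^p\right)\omega(t)\,dt\right)^{1/p}$. For $1<p<\infty$, $\omega$ belongs to the Muckenhoupt class $A_p$ on $(0,T)$ if $$[\omega]_{A_p}:=\sup_{J\subset(0,T)}\left(\frac1{|J|}\int_J\omega(t)\,dt\right)\left(\frac1{|J|}\int_J\omega(t)^{-\frac1{p-1}}dt\right)^{p-1}<\infty,$$ the supremum being over all subintervals $J$ of $(0,T)$, with the convention $0\cdot\infty=\infty$ (so $\omega\equiv0$ is excluded and both $\omega$ and $\omega^{-1/(p-1)}$ are integrable on $(0,T)$). Functions $y\in W^{2,p}_\omega(0,T)$ are identified with their continuously differentiable representatives on $[0,T]$ (with $y'$ absolutely continuous). The Caputo derivative of order $\alpha\in(0,1)$ is $D^\alpha y(t)=\frac1{\Gamma(1-\alpha)}\int_0^t\frac{y'(s)}{(t-s)^\alpha}\,ds$. The L1 scheme on the grid $t_n=n\tau$, $n\ge1$, is $$\delta_\tau^\alpha y(t_n)=\frac{\tau^{-\alpha}}{\Gamma(2-\alpha)}\left(y(t_n)-b_{n-1}y(0)-\sum_{i=1}^{n-1}(b_{n-i-1}-b_{n-i})y(t_i)\right),\qquad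 b_i=(i+1)^{1-\alpha}-i^{1-\alpha}.$$ *)

(* Defs.v *)
From mathcomp Require Import all_boot all_order all_algebra.
From mathcomp Require Import all_classical all_reals all_analysis.

Set Implicit Arguments.
Unset Strict Implicit.
Unset Printing Implicit Defensive.

Import Order.TTheory GRing.Theory Num.Theory.
Import numFieldNormedType.Exports.

Local Open Scope classical_set_scope.
Local Open Scope ring_scope.

Section weights.
Context {R : realType}.
Implicit Types (T p r : R) (w : R -> R) (J : set R).
Local Notation mu := (@lebesgue_measure R).
Local Open Scope ereal_scope.

Definition is_weight T w : Prop :=
  {in `]0%R, T[, forall t, (0 <= w t)%R} /\ locally_integrable `]0%R, T[ w.

(* w^(-r) for r > 0, equal to +oo where w vanishes. The inverse is taken in
   \bar R, where 0^-1 = +oo; the real power w t `^ (- r) would be 0 there. *)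
Definition neg_powR w r (t : R) : \bar R := (w t)%:E^-1 `^ r.

Definition mean (f : R -> \bar R) J : \bar R :=
  (mu J)^-1 * \int[mu]_(t in J) f t.

(* Product with 0 * +oo = +oo, whereas 0 * +oo = 0 for the product of \bar R. *)
Definition mule_0y (x y : \bar R) : \bar R :=
  if ((x == 0) && (y == +oo)) || ((x == +oo) && (y == 0)) then +oo else x * y.

Definition Ap_constant T p w : \bar R :=
  ereal_sup [set mule_0y (mean (EFin \o w) J)
                   (mean (neg_powR w (p - 1)^-1) J `^ (p - 1))
            | J in [set J | [/\ is_interval J, J `<=` `]0%R, T[ & 0 < mu J]]].

Definition muckenhoupt T p w : Prop :=
  is_weight T w /\ Ap_constant T p w < +oo.

End weights.

Section sobolev.
Context {R : realType}.
Implicit Types (T p : R) (w y g phi : R -> R) (k s : nat).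
Local Notation mu := (@lebesgue_measure R).

Definition Lp_weighted T p w y : Prop :=
  measurable_fun `]0, T[ y /\
  (\int[mu]_(t in `]0%R, T[) (`|y t| `^ p * w t)%:E < +oo)%E.

Definition test_function T phi : Prop :=
  [/\ forall k x, derivable (derive1n k phi) x 1,
      compact (closure [set x | phi x != 0]) &
      closure [set x | phi x != 0] `<=` `]0, T[].

Definition is_weak_derivative T k y g : Prop :=
  [/\ locally_integrable `]0, T[ y, locally_integrable `]0, T[ g &
      forall phi, test_function T phi ->
        \int[mu]_(t in `]0, T[) (y t * derive1n k phi t) =
        (-1) ^+ k * \int[mu]_(t in `]0, T[) (g t * phi t)].

(* Weak derivatives are unique up to a null set; this picks one of them when
   there is one. *)
Definition weak_derivative T k y : R -> R :=
  if k is 0 then y else get [set g | is_weak_derivative T k y g].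

Definition sobolev T s p w y : Prop :=
  forall k, (k <= s)%N ->
    (exists g, is_weak_derivative T k y g) /\
    Lp_weighted T p w (weak_derivative T k y).

Definition sobolev_norm T s p w y : \bar R :=
  ((\int[mu]_(t in `]0%R, T[)
     ((\sum_(k < s.+1) `|weak_derivative T k y t| `^ p) * w t)%:E) `^ p^-1)%E.

(* Continuously differentiable on [a, b]: the derivative on ]a, b[ extends
   continuously to [a, b], its end values being the one-sided derivatives.
   It singles out the smooth representative of an element of W^{2,p}_w; the
   absolute continuity of y' then follows from the weak y'' being integrable. *)
Definition C1_itv (a b : R) y : Prop :=
  {within `[a, b], continuous y} /\
  exists2 g : R -> R, {within `[a, b], continuous g} &
    {in `]a, b[, forall x : R, is_derive x 1 y (g x)}.

End sobolev.

Section L1_scheme.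
Context {R : realType}.
Implicit Types (alpha tau t : R) (y : R -> R).
Local Notation mu := (@lebesgue_measure R).

Definition Gamma (x : R) : R :=
  \int[mu]_(t in `]0, +oo[) (t `^ (x - 1) * expR (- t)).

Definition caputo alpha y t : R :=
  (Gamma (1 - alpha))^-1 *
  \int[mu]_(s in `]0, t[) (derive1 y s / (t - s) `^ alpha).

Definition L1_coef alpha (i : nat) : R :=
  i.+1%:R `^ (1 - alpha) - i%:R `^ (1 - alpha).

(* The value at n * tau of the L1 approximation of the Caputo derivative;
   meaningful for n >= 1. *)
Definition L1_derivative alpha tau y (n : nat) : R :=
  tau `^ (- alpha) / Gamma (2 - alpha) *
  (y (n%:R * tau) - L1_coef alpha n.-1 * y 0
   - \sum_(1 <= i < n)
       (L1_coef alpha (n - i).-1 - L1_coef alpha (n - i)) * y (i%:R * tau)).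

End L1_scheme.

Section Lambda.
Context {R : realType}.
Implicit Types (p q tau : R) (w : R -> R) (j N : nat).
Local Notation mu := (@lebesgue_measure R).
Local Open Scope ereal_scope.

Definition grid_cell tau j : set R := `](j%:R * tau)%R, (j.+1%:R * tau)%R[.

Definition cell_norm p q w tau j : \bar R :=
  'N[mu]_(q%:E)[neg_powR w p^-1 \_ (grid_cell tau j)].

Definition Lambda p q w tau N : \bar R :=
  ereal_sup [set (tau `^ (- q^-1))%:E * cell_norm p q w tau j | j in `I_N].

End Lambda.

(* Main.v *)
(* On a cell of the grid, y' differs from the slope m of the linear interpolant
   of y by at most the integral of |y''|, and y' - m has mean zero. The error of
   the scheme at c = t_n is 1 / Gamma (1 - alpha) times the sum over the cells of
   the integrals of (y' - m) k, with k s = (c - s)^(-alpha). On the last cell k is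
   integrated exactly; on the other ones the mean value zero allows to replace k
   by its increment over the cell, and these increments telescope. Hoelder's
   inequality bounds the integral of |y''| on a cell by W_j times the norm of y.
   The bound of the oscillation of y' by the integral of |y''| is obtained by
   testing the weak second derivative against differences of smooth steps. *)

Require Import Defs.
From mathcomp Require Import all_boot all_order all_algebra.
From mathcomp Require Import all_classical all_reals all_analysis.
From mathcomp Require Import measurable_realfun.
From mathcomp Require Import ring lra zify.

Set Implicit Arguments.
Unset Strict Implicit.
Unset Printing Implicit Defensive.

Import Order.TTheory GRing.Theory Num.Theory.
Import numFieldNormedType.Exports.

Local Open Scope classical_set_scope.
Local Open Scope ring_scope.

(** The second derivative of y is known only as a weak derivative picked by [get], so there is no
    classical formula to start from. A single inequality is extracted from it, the oscillation bound
    for the continuous derivative g; after that y is handled as a C^1 function. Test functions have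
    to be infinitely differentiable with compact support, which is why smooth steps are built
    explicitly from exp(-1/x). The last cell is set apart because the kernel blows up at c: its
    increment is of no use there, whereas its integral converges since alpha < 1. The factor
    tau^(1-alpha) comes from the kernel and tau^(1/q) from undoing the normalisation of W_j in
    [Lambda]; the exponents add up to 2 - alpha - 1/p. The weight enters through [Lambda] and the
    norm, so the constant depends on alpha alone. The A_p condition, taken on ]0, T[, makes
    w^(-1/(p-1)) integrable: then [Lambda] is finite and w is positive almost everywhere. *)

Section smooth_functions.
Context {R : realType}.
Implicit Types (f g : R -> R) (a r x : R) (k : nat).

(** [flat 0] is the classical smooth function exp(-1/x) extended by 0. The extra factor x^(-k) makes
    the family stable under derivation, up to linear combinations. *)
Definition flat k x : R := if 0 < x then x^-1 ^+ k * expR (- x^-1) else 0.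

Lemma flat_le0 k x : x <= 0 -> flat k x = 0.
Proof. by rewrite /flat leNgt => /negbTE ->. Qed.

Lemma flat_gt0 k x : 0 < x -> 0 < flat k x.
Proof.
by move=> x0; rewrite /flat x0 mulr_gt0 ?expR_gt0// exprn_gt0// invr_gt0.
Qed.

Lemma flat_ge0 k x : 0 <= flat k x.
Proof.
by have [/flat_le0 -> //|/(flat_gt0 k)/ltW] := leP x 0.
Qed.

(** With u = 1/x, this is exp(u) >= u^(k+2)/(k+2)!. It serves twice: for the derivative of [flat] at
    0, and for the decay at infinity of the integrand of [Gamma]. *)
Lemma flat_le_sqr k x : `|flat k x| <= k.+2`!%:R * x ^+ 2.
Proof.
rewrite ger0_norm ?flat_ge0// /flat; case: ifPn => [x0|_]; last first.
  by rewrite mulr_ge0// sqr_ge0.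
have u0 : 0 < x^-1 by rewrite invr_gt0.
have := @expR_ge1Dxn R x^-1 k.+1 (ltW u0) => h.
have {}h : x^-1 ^+ k.+2 <= k.+2`!%:R * expR x^-1.
  rewrite mulrC -ler_pdivrMr ?ltr0n ?fact_gt0//.
  by apply: le_trans h; rewrite lerDr.
rewrite expRN ler_pdivrMr ?expR_gt0// -mulrA mulrCA -ler_pdivrMl ?exprn_gt0//.
by rewrite -exprVn -exprD add2n.
Qed.

Lemma is_derive0_le_sqr f (C : R) :
  (forall x, `|f x| <= C * x ^+ 2) -> is_derive (0 : R) 1 f 0.
Proof.
move=> fC.
have f0 : f 0 = 0.
  by apply/eqP; rewrite -normr_le0; have := fC 0; rewrite expr0n/= mulr0.
have C0 : 0 <= C by have := le_trans (normr_ge0 _) (fC 1); rewrite expr1n mulr1.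
have h : (fun h : R => h^-1 *: ((f \o shift 0) (h *: 1) - f 0)) @ 0^' --> (0 : R).
  apply/cvgr0Pnorm_le => e e0; near=> h.
  have h0 : h != 0 by near: h; exact: nbhs_dnbhs_neq.
  rewrite /= f0 subr0 addr0 normrZ normfV /GRing.scale/= mulr1.
  rewrite ler_pdivrMl ?normr_gt0// (le_trans (fC h))// -real_normK ?num_real//.
  rewrite expr2 mulrCA ler_pM2l ?normr_gt0//.
  (* [C + 1] replaces [C], which may be 0. *)
  have h1 : `|h| <= e / (C + 1).
    near: h; apply: dnbhs0_le; rewrite divr_gt0// ltr_wpDl//.
  rewrite (@le_trans _ _ ((C + 1) * `|h|))// ?ler_wpM2r// ?lerDl//.
  by rewrite mulrC -ler_pdivlMr// ltr_wpDl.
apply: DeriveDef; first by apply/cvg_ex; exists 0.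
exact/cvg_lim.
Unshelve. all: by end_near. Qed.

(** Off 0 the function agrees locally with 0 or with an explicit product. At 0, where the two
    formulas meet, the quadratic bound gives derivative 0. *)
Lemma is_derive_flat k x :
  is_derive x 1 (flat k) (flat k.+2 x - k%:R * flat k.+1 x).
Proof.
have [x0|x0|->] := ltgtP x 0.
- rewrite !flat_le0 ?ltW// mulr0 subr0.
  apply: (near_eq_is_derive (f := cst 0)).
  by near=> y; rewrite flat_le0//; apply/ltW; near: y; exact: (lt_nbhsl x0).
- pose F := (fun y : R => y^-1) ^+ k * (expR \o (- (fun y : R => y^-1))).
  apply: (near_eq_is_derive (f := F)).
    near=> y; have y0 : 0 < y by near: y; exact: (lt_nbhsr x0).
    by rewrite /F /flat y0 !fctE.
  have x1 : x != 0 by rewrite gt_eqF.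
  have dV : is_derive x 1 (fun y : R => y^-1) (- x ^- 2 *: 1).
    exact: (@is_deriveV R id x 1 1 x1 (is_derive_id x 1)).
  apply: is_derive_eq.
  rewrite /flat x0 /GRing.scale/= !fctE -exprVn mulr1.
  move: x^-1 (expR _) => u e.
  (* The derivative of a k-th power involves the predecessor of k, hence the separate case k = 0. *)
  by case: (k) => [|j]; rewrite ?exprS/= ?expr0; ring.
- rewrite !flat_le0// mulr0 subr0; apply: is_derive0_le_sqr => y.
  exact: flat_le_sqr.
Unshelve. all: by end_near. Qed.

(* A class of functions that contains the smooth steps below and is closed under
   derivation: all its members are then infinitely differentiable. *)
Inductive flat_alg : (R -> R) -> Prop :=
| FlatCst (c : R) : flat_alg (cst c)
| FlatAff k (r a : R) : flat_alg (fun x => flat k (r * x + a))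
| FlatD f g : flat_alg f -> flat_alg g -> flat_alg (f + g)
| FlatM f g : flat_alg f -> flat_alg g -> flat_alg (f * g)
| FlatV f : (forall x, f x != 0) -> flat_alg f -> flat_alg (fun x => (f x)^-1).

Lemma flat_alg_derive f : flat_alg f ->
  exists2 f', flat_alg f' & forall x, is_derive x 1 f (f' x).
Proof.
elim=> {f} [c|k r a|f g _ [f' f'A df] _ [g' g'A dg]|
            f g fA [f' f'A df] gA [g' g'A dg]|f f0 fA [f' f'A df]].
- by exists (cst 0) => // [|x]; [exact: FlatCst|exact: is_derive_cst].
- exists (((fun x => flat k.+2 (r * x + a)) +
           cst (- k%:R) * (fun x => flat k.+1 (r * x + a))) * cst r).
    apply/FlatM/FlatCst/FlatD; first exact: FlatAff.
    exact/FlatM/FlatAff/FlatCst.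
  move=> x.
  have := is_derive_flat k (r * x + a) => h.
  have dl : is_derive x 1 (fun x => r * x + a) r.
    have -> : (fun x => r * x + a) = cst r * id + cst a by [].
    apply: is_derive_eq.
    by rewrite /GRing.scale/= !mulr0 !addr0 mulr1.
  apply: (is_derive_eq (is_derive1_comp (g := fun x => r * x + a) h dl)).
  by rewrite !fctE /cst mulNr.
- exists (f' + g'); [exact: FlatD|by move=> x; exact: is_deriveD].
- exists (f * g' + g * f'); first by apply: FlatD; exact: FlatM.
  by move=> x; exact: is_deriveM.
- exists ((cst (-1) * ((fun x => (f x)^-1) * (fun x => (f x)^-1))) * f').
    by apply: FlatM f'A; apply: FlatM; [exact: FlatCst|apply: FlatM; exact: FlatV].
  move=> x; apply: (is_derive_eq (is_deriveV (f0 x) (df x))).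
  by rewrite /GRing.scale/= !fctE /cst expr2 invfM mulN1r.
Qed.

Lemma flat_alg_smooth f : flat_alg f ->
  forall k x, derivable (derive1n k f) x 1.
Proof.
move=> fA k; have : flat_alg (derive1n k f).
  elim: k => // k /flat_alg_derive[f' f'A df].
  rewrite derive1nS (_ : derive1 _ = f')//; apply/funext => x.
  by rewrite derive1E derive_val.
by move=> /flat_alg_derive[f' _ df] x.
Qed.

End smooth_functions.

(** * Continuity on a segment, integrability and the fundamental theorem of calculus *)

Section calculus.
Context {R : realType}.
Implicit Types (f g F : R -> R) (a b s t x : R).
Local Notation mu := (@lebesgue_measure R).

Lemma is_derive_continuous f x (l : R) : is_derive x 1 f l -> {for x, continuous f}.
Proof.
move=> df; apply/differentiable_continuous/derivable1_diffP.
exact: (ex_derive (is_derive := df)).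
Qed.

Lemma within_continuous_integrable f a b : {within `[a, b], continuous f} ->
  mu.-integrable `[a, b] (EFin \o f).
Proof. by apply: continuous_compact_integrable; exact: segment_compact. Qed.

Lemma within_continuousM f g a b : {within `[a, b], continuous f} ->
  {within `[a, b], continuous g} -> {within `[a, b], continuous (f \* g)}.
Proof. by move=> cf cg x; apply: continuousM; [exact: cf|exact: cg]. Qed.

Lemma within_continuousB f g a b : {within `[a, b], continuous f} ->
  {within `[a, b], continuous g} -> {within `[a, b], continuous (f \- g)}.
Proof. by move=> cf cg x; apply: continuousB; [exact: cf|exact: cg]. Qed.

Lemma within_continuous_normr f a b : {within `[a, b], continuous f} ->
  {within `[a, b], continuous (fun x => `|f x|)}.
Proof.
by move=> cf x; apply: cvg_norm; exact: cf.
Qed.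

Lemma within_continuous_cst (c : R) a b : {within `[a, b], continuous (cst c)}.
Proof. by move=> x; exact: cst_continuous. Qed.

Lemma derivable_oo_LRcontinuousP F f a b : a < b ->
  {within `[a, b], continuous F} -> {in `]a, b[, forall x, is_derive x 1 F (f x)} ->
  derivable_oo_LRcontinuous F a b.
Proof.
move=> ab /(continuous_within_itvP _ ab)[_ Fa Fb] dF; split => // x xab.
by have [] := dF x xab.
Qed.

Lemma Rintegral_FTC2 F f a b : a < b ->
  {within `[a, b], continuous f} -> {within `[a, b], continuous F} ->
  {in `]a, b[, forall x, is_derive x 1 F (f x)} ->
  \int[mu]_(x in `[a, b]) f x = F b - F a.
Proof.
move=> ab cf cF dF; rewrite /Rintegral (@continuous_FTC2 _ f F)//.
  exact: derivable_oo_LRcontinuousP dF.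
by move=> x xab; rewrite derive1E (derive_val (is_derive := dF x xab)).
Qed.

End calculus.

(** * Smooth steps from 0 to 1 and their derivatives *)

Section smooth_step.
Context {R : realType}.
Implicit Types (a b x : R).
Local Notation mu := (@lebesgue_measure R).

Let den a b x : R := flat 0 (x - a) + flat 0 (b - x).

Definition step a b x : R := flat 0 (x - a) / den a b x.

(** The derivative of [step] after the cancellation in the quotient rule: in this form it is visibly
    nonnegative, and zero outside ]a, b[. *)
Definition dstep a b x : R :=
  (flat 2 (x - a) * flat 0 (b - x) + flat 0 (x - a) * flat 2 (b - x))
  / den a b x ^+ 2.

Let den_gt0 a b x : a < b -> 0 < den a b x.
Proof.
move=> ab; have [xa|ax] := leP x a.
  by rewrite ltr_wpDl ?flat_ge0// flat_gt0// subr_gt0 (le_lt_trans xa).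
by rewrite ltr_wpDr ?flat_ge0// flat_gt0// subr_gt0.
Qed.

Let flatBr k a : flat_alg (fun x : R => flat k (x - a)).
Proof.
rewrite (_ : (fun x => _) = (fun x => flat k (1 * x + - a))); first exact: FlatAff.
by apply/funext => x; rewrite mul1r.
Qed.

Let flatBl k b : flat_alg (fun x : R => flat k (b - x)).
Proof.
rewrite (_ : (fun x => _) = (fun x => flat k (-1 * x + b))); first exact: FlatAff.
by apply/funext => x; rewrite mulN1r addrC.
Qed.

Lemma flat_alg_step a b : a < b -> flat_alg (step a b).
Proof.
move=> ab; apply: FlatM; first exact: flatBr.
apply: FlatV; first by move=> x; rewrite gt_eqF ?den_gt0.
by apply: FlatD; [exact: flatBr|exact: flatBl].
Qed.

Lemma step_le a b x : x <= a -> step a b x = 0.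
Proof. by move=> xa; rewrite /step flat_le0 ?subr_le0// mul0r. Qed.

Lemma step_ge a b x : a < b -> b <= x -> step a b x = 1.
Proof.
move=> ab bx; rewrite /step /den (@flat_le0 _ _ (b - x)) ?subr_le0// addr0 divff//.
by rewrite gt_eqF// flat_gt0// subr_gt0 (lt_le_trans ab).
Qed.

Lemma step_itv a b x : a < b -> 0 <= step a b x <= 1.
Proof.
move=> ab; rewrite /step divr_ge0 ?flat_ge0 ?(ltW (den_gt0 _ ab))//=.
by rewrite ler_pdivrMr ?den_gt0// mul1r lerDl flat_ge0.
Qed.

Lemma dstep_ge0 a b x : 0 <= dstep a b x.
Proof. by rewrite divr_ge0 ?sqr_ge0// addr_ge0// mulr_ge0// flat_ge0. Qed.

Lemma dstep_out a b x : (x <= a) || (b <= x) -> dstep a b x = 0.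
Proof.
by move=> /orP[xa|bx]; rewrite /dstep;
  [rewrite !(@flat_le0 _ _ (x - a)) ?subr_le0//|
   rewrite !(@flat_le0 _ _ (b - x)) ?subr_le0//]; rewrite !(mulr0, mul0r) addr0 mul0r.
Qed.

Lemma is_derive_step a b x : a < b -> is_derive x 1 (step a b) (dstep a b x).
Proof.
move=> ab.
have dr : is_derive x 1 (fun x => flat 0 (x - a)) (flat 2 (x - a)).
  have h := is_derive_flat 0 (x - a).
  have dl : is_derive x 1 (fun x => x - a) (1 - 0) by exact: is_deriveB.
  apply: (is_derive_eq (is_derive1_comp (g := fun x => x - a) h dl)).
  by rewrite mul0r !subr0 mulr1.
have dl : is_derive x 1 (fun x => flat 0 (b - x)) (- flat 2 (b - x)).
  have h := is_derive_flat 0 (b - x).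
  have dl : is_derive x 1 (fun x => b - x) (0 - 1) by exact: is_deriveB.
  apply: (is_derive_eq (is_derive1_comp (g := fun x => b - x) h dl)).
  by rewrite mul0r subr0 sub0r mulrN1.
have d0 : den a b x != 0 by rewrite gt_eqF ?den_gt0.
have dD : is_derive x 1 (den a b) (flat 2 (x - a) - flat 2 (b - x)).
  exact: is_deriveD.
apply: (is_derive_eq (is_deriveM dr (is_deriveV d0 dD))).
rewrite /GRing.scale/= /dstep.
have : den a b x = flat 0 (x - a) + flat 0 (b - x) by [].
move: (den a b x) d0 => D D0 DE.
(* [field] takes [D] as an atom; this substitution hands it the relation between [D] and its two
   summands. *)
have -> : flat 0 (b - x) = D - flat 0 (x - a) by rewrite DE addrAC subrr add0r.
by field.
Qed.

Lemma continuous_step a b : a < b -> continuous (step a b).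
Proof. by move=> ab x; have /is_derive_continuous := is_derive_step x ab. Qed.

Lemma derive1_step a b : a < b -> derive1 (step a b) = dstep a b.
Proof.
move=> ab; apply/funext => x.
by rewrite derive1E (derive_val (is_derive := is_derive_step x ab)).
Qed.

Lemma derivable_dstep a b x : a < b -> derivable (dstep a b) x 1.
Proof.
move=> ab; rewrite -derive1_step//.
exact: (@flat_alg_smooth _ _ (flat_alg_step ab) 1%N x).
Qed.

Lemma continuous_dstep a b : a < b -> continuous (dstep a b).
Proof.
by move=> ab x; exact/differentiable_continuous/derivable1_diffP/derivable_dstep.
Qed.

(* [dstep a b] is a probability density on [a, b]. *)
Lemma dstep_average (g : R -> R) s t a b (c e : R) :
    s <= a -> a < b -> b <= t -> {within `[s, t], continuous g} ->
    (forall x, a <= x <= b -> `|g x - c| <= e) ->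
  `|\int[mu]_(x in `[s, t]) (g x * dstep a b x) - c| <= e.
Proof.
move=> sa ab bt cg ge; have st : s < t by rewrite (le_lt_trans sa)// (lt_le_trans ab).
have cd : {within `[s, t], continuous (dstep a b)}.
  exact/continuous_subspaceT/continuous_dstep.
have I1 : \int[mu]_(x in `[s, t]) dstep a b x = 1.
  rewrite (@Rintegral_FTC2 _ (step a b))//.
  - by rewrite step_ge// step_le// subr0.
  - exact/continuous_subspaceT/continuous_step.
  - by move=> x _; exact: is_derive_step.
have iM (f : R -> R) : {within `[s, t], continuous f} ->
    mu.-integrable `[s, t] (EFin \o (fun x => f x * dstep a b x)).
  by move=> cf; apply: within_continuous_integrable; exact: within_continuousM.
have cc (k : R) : {within `[s, t], continuous (cst k)}.
  exact: within_continuous_cst.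
(* As the density has mass 1, c is itself an integral against it, and so is e: it remains to compare
   integrands, on [a, b] by hypothesis and elsewhere because both are 0. *)
rewrite -[c in _ - c]mulr1 -{1}I1 -RintegralZl//; last first.
  exact: within_continuous_integrable.
rewrite -RintegralB//; [|exact: iM|exact: (iM (cst c))].
rewrite (le_trans (le_normr_Rintegral _ _))//.
  apply: within_continuous_integrable; apply: within_continuousB.
    exact: within_continuousM.
  exact: (@within_continuousM _ (cst c)).
rewrite -[leRHS]mulr1 -[X in _ <= _ * X]I1 -RintegralZl//; last first.
  exact: within_continuous_integrable.
apply: le_Rintegral => //; last 2 first.
- exact: (iM (cst e)).
- move=> x _; rewrite -mulrBl normrM (ger0_norm (dstep_ge0 _ _ _)).
  have [xab|xab] := boolP (a <= x <= b).
    by rewrite ler_wpM2r ?dstep_ge0// ge.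
  rewrite dstep_out ?mulr0//.
  by move: xab; rewrite negb_and -!ltNge => /orP[]/ltW ->; rewrite ?orbT.
- apply/within_continuous_integrable/within_continuous_normr/within_continuousB.
    exact: within_continuousM.
  exact: (@within_continuousM _ (cst c)).
Qed.

End smooth_step.

(** * From the weak second derivative to the oscillation of the first one *)

Section weak_second_derivative.
Context {R : realType}.
Implicit Types (y g v : R -> R) (s t T x : R).
Local Notation mu := (@lebesgue_measure R).

Lemma Rintegral_supp (A B : set R) (f : R -> R) : A `<=` B ->
  (forall x, ~ A x -> f x = 0) -> \int[mu]_(x in B) f x = \int[mu]_(x in A) f x.
Proof.
move=> AB f0; rewrite -[in RHS](setIidr AB) Rintegral_mkcondr.
apply: eq_Rintegral => x _; rewrite patchE.
by case: ifPn => // /negP xA; rewrite f0// => Ax; apply: xA; rewrite inE.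
Qed.

(** The complement of the segment is open, so f vanishes on a whole neighbourhood of x. *)
Lemma derive1_out_segment (f : R -> R) s t x :
  (forall x, ~ `[s, t]%classic x -> f x = 0) -> ~ `[s, t]%classic x ->
  derive1 f x = 0.
Proof.
move=> f0 xst; rewrite derive1E -(derive_cst (0 : R) x 1).
apply: near_eq_derive.
have : open (~` `[s, t]%classic) by apply: closed_openC; exact: itv_closed.
move=> /(_ x xst); apply: filterS => z zst.
exact: f0.
Qed.

Lemma locally_integrable_segment T v s t : 0 < s -> t < T ->
  locally_integrable `]0, T[ v -> mu.-integrable `[s, t] (EFin \o v).
Proof.
move=> s0 tT [mv _ iv].
have st : `[s, t] `<=` `]0, T[.
  move=> x/=; rewrite !in_itv/= => /andP[sx xt].
  by rewrite (lt_le_trans s0)// (le_lt_trans xt).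
apply/integrableP; split.
  by apply/measurable_EFinP; exact: measurable_funS mv.
by apply: iv => //; exact: segment_compact.
Qed.

(* Tested against a phi that climbs smoothly from 0 to 1 just after s and goes
   back to 0 just before t, the weak identity reads
   - \int g phi' = \int v phi, where phi' is a difference of two probability
   densities concentrated near s and near t. *)
Lemma weak_derivative2_dist T y g v s t :
    {within `[0, T], continuous g} ->
    {in `]0, T[, forall x, is_derive x 1 y (g x)} ->
    is_weak_derivative T 2 y v -> 0 < s -> s < t -> t < T ->
  `|g t - g s| <= \int[mu]_(x in `[s, t]) `|v x|.
Proof.
move=> cg dy [_ lv wv] s0 st tT.
have T0 : 0 < T by rewrite (lt_trans s0)// (lt_trans st).
have stT : `[s, t] `<=` `]0, T[.
  move=> x/=; rewrite !in_itv/= => /andP[sx xt].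
  by rewrite (lt_le_trans s0)// (le_lt_trans xt).
have iv := locally_integrable_segment s0 tT lv.
have cgst : {within `[s, t], continuous g}.
  by apply: continuous_subspaceW cg => x /stT; exact: subset_itv_oo_cc.
have cyst : {within `[s, t], continuous y}.
  apply: continuous_in_subspaceT => x; rewrite inE => /stT xT.
  exact: (is_derive_continuous (dy x xT)).
(* The averages of g near s and near t are only within e / 2 of g s and g t, so the inequality is
   proved up to an arbitrary e. *)
apply/ler_addgt0Pr => e e0.
have e20 : 0 < e / 2 by rewrite divr_gt0.
have cgx x : `[s, t]%classic x -> {for x, continuous g}.
  move=> /stT xT; have /(continuous_within_itvP _ T0)[+ _ _] := cg.
  exact.
have near_d x : `[s, t]%classic x ->
    exists2 d : R, 0 < d & forall z, `|x - z| < d -> `|g z - g x| <= e / 2.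
  move=> /cgx /cvgrPdist_le /(_ _ e20)[d/= d0 dg].
  by exists d => // z xz; rewrite distrC; exact: dg.
have [|d1 d10 g1] := near_d s; first by rewrite /= in_itv/= lexx ltW.
have [|d2 d20 g2] := near_d t; first by rewrite /= in_itv/= lexx ltW.
(* The bound (t - s) / 2 keeps the rising and the falling step apart; halving d1 and d2 keeps the
   closed intervals [s, a] and [b, t] strictly inside the neighbourhoods given by continuity of
   g. *)
pose a := s + Num.min (d1 / 2) ((t - s) / 2).
pose b := t - Num.min (d2 / 2) ((t - s) / 2).
have ts0 : 0 < (t - s) / 2 by rewrite divr_gt0// subr_gt0.
have sa : s < a by rewrite ltrDl lt_min ts0 divr_gt0.
have bt : b < t by rewrite ltrBlDr ltrDl lt_min ts0 divr_gt0.
have aD : a <= s + (t - s) / 2 by rewrite lerD2l ge_min lexx orbT.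
have bD : t - (t - s) / 2 <= b by rewrite lerB// ge_min lexx orbT.
have ab : a <= b by lra.
have ad1 : a <= s + d1 / 2 by rewrite lerD2l ge_min lexx.
have bd2 : t - d2 / 2 <= b by rewrite lerB// ge_min lexx.
have {}g1 x : s <= x <= a -> `|g x - g s| <= e / 2.
  move=> /andP[sx xa]; apply: g1; rewrite distrC ger0_norm ?subr_ge0//; lra.
have {}g2 x : b <= x <= t -> `|g x - g t| <= e / 2.
  move=> /andP[bx xt]; apply: g2; rewrite ger0_norm ?subr_ge0//; lra.
pose phi x := step s a x - step b t x.
pose dphi x := dstep s a x - dstep b t x.
have phiA : flat_alg phi.
  rewrite (_ : phi = step s a + cst (-1) * step b t).
    apply: FlatD; first exact: flat_alg_step.
    by apply: FlatM; [exact: FlatCst|exact: flat_alg_step].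
  by apply/funext => x; rewrite !fctE mulN1r.
have dphiE : derive1 phi = dphi.
  apply/funext => x; rewrite derive1E.
  have h := is_deriveB (is_derive_step x sa) (is_derive_step x bt).
  by rewrite (derive_val (is_derive := h)).
have d2phi x : derivable dphi x 1.
  by rewrite -dphiE; exact: (@flat_alg_smooth _ _ phiA 1%N x).
have cdphi : continuous dphi.
  by move=> x; exact/differentiable_continuous/derivable1_diffP.
have cd2phi : continuous (derive1 dphi).
  move=> x; apply/differentiable_continuous/derivable1_diffP; rewrite -dphiE.
  exact: (@flat_alg_smooth _ _ phiA 2%N x).
have phi0 x : ~ `[s, t]%classic x -> phi x = 0.
  rewrite /= in_itv/= => /negP; rewrite negb_and -!ltNge => /orP[xs|tx].
    by rewrite /phi !step_le ?subrr//; lra.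
  by rewrite /phi !step_ge ?subrr//; lra.
have dphi0 x : ~ `[s, t]%classic x -> dphi x = 0.
  by move=> xst; rewrite -dphiE; apply: derive1_out_segment xst.
have phi1 x : `|phi x| <= 1.
  have /andP[u0 u1] := step_itv x sa; have /andP[w0 w1] := step_itv x bt.
  by rewrite /phi ler_norml; apply/andP; split; lra.
have supp : closure [set x | phi x != 0] `<=` `[s, t].
  have -> : `[s, t]%classic = closure `[s, t]%classic.
    by apply/closure_id; exact: itv_closed.
  by apply: closureS => x /eqP px; apply: contrapT => /phi0.
have test : test_function T phi.
  split; first by move=> k x; exact: flat_alg_smooth.
    apply: subclosed_compact supp; [exact: closed_closure|exact: segment_compact].
  exact: subset_trans supp stT.
have := wv phi test.
rewrite (Rintegral_supp stT); last first.
  by move=> x xst; rewrite /= dphiE (derive1_out_segment dphi0 xst) mulr0.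
rewrite (@Rintegral_supp _ _ (fun x => v x * phi x) stT); last first.
  by move=> x xst; rewrite phi0// mulr0.
rewrite sqrrN expr1n mul1r /= dphiE.
(* One integration by parts moves a derivative from phi'' back to y. Its boundary terms vanish
   because both densities are 0 at s and at t. *)
rewrite (@Rintegration_by_parts _ y dphi g (derive1 dphi) s t st cgst); last 5 first.
- apply: (derivable_oo_LRcontinuousP (f := g) st cyst) => x xst.
  exact/dy/stT/subset_itv_oo_cc.
- move=> x xst; rewrite derive1E (derive_val (is_derive := dy x _))//.
  by apply: stT; exact: subset_itv_oo_cc.
- exact: continuous_subspaceT.
- apply: (derivable_oo_LRcontinuousP (f := derive1 dphi) st).
    exact: continuous_subspaceT.
  by move=> x _; rewrite derive1E; exact/derivableP.
- by move=> x _.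
have -> : dphi t = 0 by rewrite /dphi !dstep_out ?subrr ?lexx ?orbT//; lra.
have -> : dphi s = 0 by rewrite /dphi !dstep_out ?subrr ?lexx//; apply/orP; left; lra.
rewrite !mulr0 subrr sub0r => Iv.
have [cs cb] : {within `[s, t], continuous (dstep s a)} /\
    {within `[s, t], continuous (dstep b t)}.
  by split; exact/continuous_subspaceT/continuous_dstep.
have Ig : \int[mu]_(x in `[s, t]) (g x * dphi x) =
    \int[mu]_(x in `[s, t]) (g x * dstep s a x) -
    \int[mu]_(x in `[s, t]) (g x * dstep b t x).
  rewrite -RintegralB//; try by apply: within_continuous_integrable; exact: within_continuousM.
  by apply: eq_Rintegral => x _; rewrite mulrBr.
have A1 := @dstep_average R g s t s a _ _ (lexx s) sa (le_trans ab (ltW bt)) cgst g1.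
have A2 := @dstep_average R g s t b t _ _ (le_trans (ltW sa) ab) bt (lexx t) cgst g2.
have A3 : `|\int[mu]_(x in `[s, t]) (v x * phi x)| <= \int[mu]_(x in `[s, t]) `|v x|.
  have ivn : mu.-integrable `[s, t] (EFin \o (fun x => `|v x|)).
    by have := integrable_norm iv; apply.
  have ivp : mu.-integrable `[s, t] (EFin \o (fun x => v x * phi x)).
    apply: le_integrable ivn => //.
      apply/measurable_EFinP/measurable_funM.
        by have /integrableP[/measurable_EFinP] := iv.
      apply: subspace_continuous_measurable_fun => //.
      apply: continuous_subspaceT => x.
      by apply: continuousB; exact: continuous_step.
    move=> x _; rewrite /= lee_fin normr_id normrM.
    by rewrite ler_piMr.
  rewrite (le_trans (le_normr_Rintegral _ ivp))//.
  apply: le_Rintegral => //; first by have := integrable_norm ivp; apply.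
  by move=> x _; rewrite normrM ler_piMr.
(* The average of g near t minus the one near s equals the integral of v phi; replacing the averages
   by g t and g s costs e / 2 each. *)
move: A1 A2 A3 Iv; rewrite Ig.
move: (\int[mu]_(x in _) _) (\int[mu]_(x in _) _) => I1 I2.
move: (\int[mu]_(x in _) _) (\int[mu]_(x in _) _) => I3 I4.
rewrite !ler_norml => /andP[u1 u2] /andP[u3 u4] /andP[u5 u6] Iv.
by clear - u1 u2 u3 u4 u5 u6 Iv; apply/andP; split; lra.
Qed.

End weak_second_derivative.

(** * An improper fundamental theorem of calculus and the functional equation of [Gamma] *)

Section Gamma_function.
Context {R : realType}.
Implicit Types (f F : R -> R) (a b x : R).
Local Notation mu := (@lebesgue_measure R).

(** f may be unbounded at the ends, as the kernel is at c. Since f >= 0, monotone convergence along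
    compact subintervals applies, and continuity of F up to the ends gives the limit. Stating it in
    [\bar R] yields integrability as well. *)
Lemma ge0_FTC2_oo F f a b : a < b -> {within `[a, b], continuous F} ->
    {in `]a, b[, continuous f} -> {in `]a, b[, forall x, 0 <= f x} ->
    {in `]a, b[, forall x, is_derive x 1 F (f x)} ->
  (\int[mu]_(x in `]a, b[) (f x)%:E = (F b - F a)%:E)%E.
Proof.
move=> ab cF cf f0 dF.
have /(continuous_within_itvP _ ab)[_ Fa Fb] := cF.
(* The 3 makes [a + h n, b - h n] nondegenerate from n = 0 on. *)
pose h (n : nat) := (b - a) / n.+3%:R.
have h0 n : 0 < h n by rewrite divr_gt0// subr_gt0.
have hb n : h n * 3 <= b - a.
  rewrite /h mulrAC ler_pdivrMr// ler_wpM2l ?subr_ge0 ?(ltW ab)//.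
  by rewrite ler_nat.
have hnd m n : (m <= n)%N -> h n <= h m.
  move=> mn; rewrite ler_wpM2l ?subr_ge0 ?(ltW ab)//.
  by rewrite lef_pV2 ?posrE// ler_nat.
have hcvg : h n @[n --> \oo] --> (0 : R).
  rewrite -(mulr0 (b - a)); apply: cvgMr.
  have := @cvg_harmonic R; rewrite -(cvg_shiftn 2); apply: cvg_trans.
  by apply: near_eq_cvg; near=> n; rewrite /= addn2.
pose I n := `[a + h n, b - h n]%classic.
have IE : \bigcup_n I n = `]a, b[%classic.
  apply/seteqP; split => x/=.
    move=> [n _]; rewrite /I/= !in_itv/= => /andP[ax xb].
    by rewrite (lt_le_trans _ ax) ?ltrDl// (le_lt_trans xb)// ltrBlDr ltrDl.
  rewrite in_itv/= => /andP[ax xb].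
  have d0 : 0 < Num.min (x - a) (b - x) by rewrite lt_min !subr_gt0 ax.
  have /cvgr0Pnorm_le/(_ _ d0)[n _ /(_ n (leqnn n))] := hcvg.
  rewrite ger0_norm ?(ltW (h0 n))// le_min => /andP[h1 h2].
  by exists n => //; rewrite /I/= in_itv/=; apply/andP; split; lra.
have II n : I n `<=` `]a, b[ by rewrite -IE; exact: bigcup_sup.
have lim1 : (\int[mu]_(x in I n) (f x)%:E)%E @[n --> \oo] -->
    (\int[mu]_(x in `]a, b[) (f x)%:E)%E.
  rewrite -IE; apply: ge0_nondecreasing_set_cvg_integral => //.
  - apply/nondecreasing_seqP => n; rewrite subsetEset => x; rewrite /I/= !in_itv/=.
    have := hnd _ _ (leqnSn n) => hh /andP[? ?].
    by apply/andP; split; lra.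
  - by move=> n; exact: measurable_itv.
  - move=> n; apply/measurable_EFinP.
    apply: (measurable_funS _ (@II n)) => //.
    apply: open_continuous_measurable_fun; first exact: interval_open.
    by apply/in_continuous_mksetP.
  - by move=> n x /II xab; rewrite lee_fin f0.
have lim2 : (\int[mu]_(x in I n) (f x)%:E)%E @[n --> \oo] --> (F b - F a)%:E.
  have E n : (\int[mu]_(x in I n) (f x)%:E)%E = (F (b - h n) - F (a + h n))%:E.
    have hab : a + h n < b - h n by have := hb n; have := h0 n; lra.
    rewrite /I EFinB; apply: continuous_FTC2 => //.
    - by apply: continuous_in_subspaceT => x; rewrite inE => /II; exact: cf.
    - apply: (derivable_oo_LRcontinuousP (f := f)) => //.
        by apply: continuous_subspaceW cF => x /II; exact: subset_itv_oo_cc.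
      by move=> x xI; apply/dF/(@II n)/subset_itv_oo_cc.
    - move=> x xI; have xab : x \in `]a, b[ by apply/(@II n)/subset_itv_oo_cc.
      by rewrite derive1E (derive_val (is_derive := dF x xab)).
  under eq_fun do rewrite E.
  apply: cvg_EFin; first by apply: nearW.
  apply: cvgB.
    apply: ((cvg_at_leftP _ _ _).1 Fb (fun n => b - h n)); split.
      by move=> n; rewrite ltrBlDr ltrDl.
    by rewrite -[X in _ --> X]subr0; apply: cvgB => //; exact: cvg_cst.
  apply: ((cvg_at_rightP _ _ _).1 Fa (fun n => a + h n)); split.
    by move=> n; rewrite ltrDl.
  by rewrite -[X in _ --> X]addr0; apply: cvgD => //; exact: cvg_cst.
exact: (cvg_unique _ lim1 lim2).
Unshelve. all: by end_near. Qed.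

(** The shift by 2 keeps [invSn n] below 1, so that [[invSn n], n + 2] is nondegenerate for every
    n. *)
Let invSn (n : nat) : R := n.+2%:R^-1.

Let invSn_gt0 n : 0 < invSn n. Proof. by rewrite invr_gt0. Qed.

Let invSn_cvg0 : invSn n @[n --> \oo] --> (0 : R).
Proof.
have := @cvg_harmonic R; rewrite -(cvg_shiftn 1); apply: cvg_trans.
by apply: near_eq_cvg; near=> n; rewrite /invSn /= addn1.
Unshelve. all: by end_near. Qed.

(** For an integer k >= a, the term is at most [flat k] at 1/(n+2), so the quadratic bound of [flat]
    applies. *)
Let powRexpRN_cvg0 a : 0 < a ->
  n.+2%:R `^ a * expR (- n.+2%:R) @[n --> \oo] --> (0 : R).
Proof.
move=> a0; pose k := Num.bound a.
apply: (@squeeze_cvgr _ _ _ _ (cst 0) (fun n => k.+2`!%:R * invSn n)).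
- near=> n; rewrite mulr_ge0 ?powR_ge0 ?expR_ge0//=.
  have n1 : 1 <= n.+2%:R :> R by rewrite ler1n.
  have := flat_le_sqr k (invSn n).
  rewrite ger0_norm ?flat_ge0// /flat invSn_gt0 invrK => h.
  rewrite (@le_trans _ _ (n.+2%:R ^+ k * expR (- n.+2%:R)))//.
    rewrite ler_wpM2r ?expR_ge0// -powR_mulrn// ler_powR//.
    by rewrite ltW// archi_boundP// ltW.
  rewrite (le_trans h)// ler_wpM2l// expr2 ler_piMl ?(ltW (invSn_gt0 _))//.
  by rewrite invf_le1.
- exact: cvg_cst.
- by rewrite -(mulr0 (k.+2`!%:R)); apply: cvgMr.
Unshelve. all: by end_near. Qed.

(* Integration by parts on [1/(n+2), n+2], then monotone convergence in \bar R. *)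
Lemma GammaD1 a : 0 < a -> Gamma (a + 1) = a * Gamma a :> R.
Proof.
move=> a0; rewrite /Gamma addrK.
pose f1 t : R := t `^ (a - 1) * expR (- t).
pose f2 t : R := t `^ a * expR (- t).
have dF (t : R) : 0 < t -> is_derive t 1 f2 (a * f1 t - f2 t).
  move=> t0; have dp := is_derive1_powR a t0.
  have de : is_derive t 1 (fun t : R => expR (- t)) (expR (- t) * - 1).
    exact: (is_derive1_comp (g := -%R) _ (is_deriveNid _ _)).
  apply: (is_derive_eq (is_deriveM dp de)).
  by rewrite /GRing.scale/= /f1 /f2; ring.
have cf2 (t : R) : 0 < t -> {for t, continuous f2}.
  by move=> /dF; exact: is_derive_continuous.
have cf1 (t : R) : 0 < t -> {for t, continuous f1}.
  move=> t0; have dp := is_derive1_powR (a - 1) t0.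
  have de : is_derive t 1 (fun t : R => expR (- t)) (expR (- t) * - 1).
    exact: (is_derive1_comp (g := -%R) _ (is_deriveNid _ _)).
  exact: (is_derive_continuous (is_deriveM dp de)).
pose I n := `[invSn n, n.+2%:R]%classic.
have I0 n x : I n x -> 0 < x.
  by rewrite /I/= in_itv/= => /andP[+ _]; exact: lt_le_trans.
have IE : \bigcup_n I n = `]0, +oo[%classic.
  apply/seteqP; split => x/=.
    by move=> [n _ /I0]; rewrite in_itv/= andbT.
  rewrite in_itv/= andbT => x0.
  pose n := (Num.bound x + Num.bound x^-1)%N.
  have xb : x < (Num.bound x)%:R by rewrite archi_boundP// ltW.
  have vb : x^-1 < (Num.bound x^-1)%:R by rewrite archi_boundP// invr_ge0 ltW.
  exists n => //; rewrite /I/= in_itv/=; apply/andP; split.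
    rewrite /invSn -[leRHS]invrK lef_pV2 ?posrE ?invr_gt0//.
    by rewrite (le_trans (ltW vb))// ler_nat /n; lia.
  by rewrite (le_trans (ltW xb))// ler_nat /n; lia.
have limI f : (forall x : R, 0 < x -> 0 <= f x) ->
    (forall x : R, 0 < x -> {for x, continuous f}) ->
    (\int[mu]_(x in I n) (f x)%:E)%E @[n --> \oo] -->
    (\int[mu]_(x in `]0%R, +oo[) (f x)%:E)%E.
  move=> f0 cf; rewrite -IE; apply: ge0_nondecreasing_set_cvg_integral => //.
  - apply/nondecreasing_seqP => n; rewrite subsetEset => x; rewrite /I/= !in_itv/=.
    move=> /andP[h1 h2]; apply/andP; split.
      by rewrite (le_trans _ h1)// lef_pV2 ?posrE// ler_nat.
    by rewrite (le_trans h2)// ler_nat.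
  - by move=> n; exact: measurable_itv.
  - move=> n; apply/measurable_EFinP.
    have IJ : I n `<=` `]0, +oo[ by move=> x /I0; rewrite /= in_itv/= andbT.
    apply: (measurable_funS _ IJ) => //.
    apply: open_continuous_measurable_fun; first exact: interval_open.
    by move=> x; rewrite inE/= in_itv/= andbT; exact: cf.
  - by move=> n x /I0 x0; rewrite lee_fin f0.
have f1_ge0 x : 0 <= f1 x by rewrite mulr_ge0 ?powR_ge0 ?expR_ge0.
have f2_ge0 x : 0 <= f2 x by rewrite mulr_ge0 ?powR_ge0 ?expR_ge0.
have af1_ge0 x : 0 <= a * f1 x by rewrite mulr_ge0// ltW.
have caf1 (t : R) : 0 < t -> {for t, continuous (fun t : R => a * f1 t)}.
  by move=> /cf1 c1; apply: cvgM => //; exact: cvg_cst.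
have lim1 := limI (fun t : R => a * f1 t) (fun x _ => af1_ge0 x) caf1.
have lim2 := limI f2 (fun x _ => f2_ge0 x) cf2.
have lim0 : (f2 n.+2%:R - f2 (invSn n))%:E @[n --> \oo] --> (0%:E : \bar R).
  apply: cvg_EFin; first exact: nearW.
  rewrite -[X in _ --> X]subr0; apply: cvgB; first exact: powRexpRN_cvg0.
  have h := (cvg_at_rightP _ _ _).1 (powR_cvg0 a0) invSn (conj invSn_gt0 invSn_cvg0).
  apply: (@squeeze_cvgr _ _ _ _ (cst 0) (fun n => invSn n `^ a)) => //; last exact: cvg_cst.
  near=> n; rewrite f2_ge0 /f2 ler_piMr ?powR_ge0//.
  by rewrite expR_le1 oppr_le0 ltW.
have E n : (\int[mu]_(x in I n) (a * f1 x)%:E =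
    \int[mu]_(x in I n) (f2 x)%:E + (f2 n.+2%:R - f2 (invSn n))%:E)%E.
  have [i1 i2] : mu.-integrable (I n) (EFin \o (fun x => a * f1 x)) /\
      mu.-integrable (I n) (EFin \o f2).
    split; apply: within_continuous_integrable; apply: continuous_in_subspaceT => x;
      by rewrite inE => /I0 x0; do [exact: caf1|exact: cf2].
  have lt2 : invSn n < n.+2%:R.
    by rewrite (@lt_trans _ _ 1) ?invf_lt1// ltr1n.
  rewrite -(@Rintegral_FTC2 _ f2 (fun x => a * f1 x - f2 x) _ _ lt2); last 3 first.
  - apply: continuous_in_subspaceT => x; rewrite inE => /I0 x0.
    by apply: cvgB; [exact: caf1|exact: cf2].
  - by apply: continuous_in_subspaceT => x; rewrite inE => /I0; exact: cf2.
  - by move=> x xI; apply/dF/(I0 n)/subset_itv_oo_cc.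
  rewrite (RintegralB _ i1 i2)//; last exact: measurable_itv.
  have n1 : (\int[mu]_(x in I n) (a * f1 x)%:E)%E \is a fin_num.
    by apply: integrable_fin_num i1; exact: measurable_itv.
  have n2 : (\int[mu]_(x in I n) (f2 x)%:E)%E \is a fin_num.
    by apply: integrable_fin_num i2; exact: measurable_itv.
  rewrite EFinB /Rintegral !fineK//.
  by rewrite addeC subeK.
have lim3 : (\int[mu]_(x in I n) (a * f1 x)%:E)%E @[n --> \oo] -->
    (\int[mu]_(x in `]0%R, +oo[) (f2 x)%:E)%E.
  rewrite -[X in _ --> X]adde0; under eq_fun do rewrite E.
  by apply: cvgeD => //; rewrite fin_num_adde_defl.
rewrite /Rintegral.
have <- := cvg_unique (@ereal_hausdorff R) lim1 lim3.
have -> : (\int[mu]_(x in `]0%R, +oo[) (a * f1 x)%:E =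
    a%:E * \int[mu]_(x in `]0%R, +oo[) (f1 x)%:E)%E.
  transitivity (\int[mu]_(x in `]0%R, +oo[) (a%:E * (EFin \o f1) x))%E.
    by apply: eq_integral => x _; rewrite EFinM.
  apply: ge0_integralZl_EFin => //.
  - by move=> x _; rewrite lee_fin.
  - apply/measurable_EFinP; apply: open_continuous_measurable_fun; first exact: interval_open.
    by move=> x; rewrite inE/= in_itv/= andbT; exact: cf1.
  - exact: ltW.
(* At an infinite value [fine] makes both sides 0, so the identity holds in every case. *)
case: (\int[mu]_(x in _) _)%E => [r||].
- by rewrite -EFinM.
- by rewrite gt0_muley// mulr0.
- by rewrite gt0_muleNy// mulr0.
Unshelve. all: by end_near. Qed.

End Gamma_function.

Section integrable_real.
Context d (T : measurableType d) (R : realType) (mu : {measure set T -> \bar R}).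
Implicit Types (A : set T) (f g : T -> R) (c : R).

Lemma integrable_mulrl A f c : measurable A -> mu.-integrable A (EFin \o f) ->
  mu.-integrable A (EFin \o (fun x => c * f x)).
Proof. by move=> mA fi; exact: (integrableZl mA c fi). Qed.

Lemma integrable_mulrr A f c : measurable A -> mu.-integrable A (EFin \o f) ->
  mu.-integrable A (EFin \o (fun x => f x * c)).
Proof. by move=> mA fi; exact: (integrableZr mA c fi). Qed.

Lemma integrable_subr A f g : measurable A -> mu.-integrable A (EFin \o f) ->
  mu.-integrable A (EFin \o g) -> mu.-integrable A (EFin \o (fun x => f x - g x)).
Proof. by move=> mA fi gi; exact: (integrableB mA fi gi). Qed.

End integrable_real.

(** * The kernel of the Caputo derivative and integrals over one cell *)

Section fractional_kernel.
Context {R : realType}.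
Implicit Types (g y k : R -> R) (a b c alpha tau : R).
Local Notation mu := (@lebesgue_measure R).

(** An inverse instead of a negative power, to match the quotient in [caputo]. *)
Definition frac_kernel alpha c s : R := ((c - s) `^ alpha)^-1.

Lemma frac_kernel_ge0 alpha c s : 0 <= frac_kernel alpha c s.
Proof. by rewrite invr_ge0 powR_ge0. Qed.

Lemma is_derive_powRBl r c s : s < c ->
  is_derive s 1 (fun s => (c - s) `^ r) (- (r * (c - s) `^ (r - 1))).
Proof.
move=> sc; have d0 : 0 < c - s by rewrite subr_gt0.
have dl : is_derive s 1 (fun s => c - s) (0 - 1) by exact: is_deriveB.
have dp := is_derive1_powR r d0.
apply: (is_derive_eq (is_derive1_comp (g := fun s => c - s) dp dl)).
by rewrite sub0r mulrN1.
Qed.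

Lemma continuous_frac_kernel alpha c s : s < c -> {for s, continuous (frac_kernel alpha c)}.
Proof.
move=> sc; apply: cvgV.
  by rewrite gt_eqF// powR_gt0// subr_gt0.
exact: (is_derive_continuous (is_derive_powRBl alpha sc)).
Qed.

(** The endpoint b = c is included, where r > 0 is what gives continuity: the primitive of the
    kernel is used up to c on the last cell. *)
Lemma within_continuous_powRBl r a b c : 0 < r -> b <= c ->
  {within `[a, b], continuous (fun s => (c - s) `^ r)}.
Proof.
move=> r0 bc; apply: continuous_subspaceW (_ : `[a, b] `<=` `]-oo, c]) _.
  by move=> x/=; rewrite !in_itv/= => /andP[_ /le_trans]; exact.
apply/continuous_within_itvNycP; split.
  move=> s; rewrite in_itv/= => sc.
  exact: (is_derive_continuous (is_derive_powRBl r sc)).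
rewrite subrr powR0 ?gt_eqF//.
apply/cvg_at_leftP => u [uc ucvg].
apply: ((cvg_at_rightP _ _ _).1 (powR_cvg0 r0) (fun n => c - u n)); split.
  by move=> n; rewrite subr_gt0.
by rewrite -(subrr c); apply: cvgB => //; exact: cvg_cst.
Qed.

Lemma integral_frac_kernel alpha a b c : 0 < alpha < 1 -> a < b -> b <= c ->
  (\int[mu]_(s in `]a, b[) (frac_kernel alpha c s)%:E =
   (((c - a) `^ (1 - alpha) - (c - b) `^ (1 - alpha)) / (1 - alpha))%:E)%E.
Proof.
move=> /andP[al0 al1] ab bc; have al : 0 < 1 - alpha by rewrite subr_gt0.
pose F s := - (c - s) `^ (1 - alpha) / (1 - alpha).
rewrite (@ge0_FTC2_oo _ F)//.
- by congr EFin; rewrite /F; field; rewrite gt_eqF.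
- have h := within_continuous_powRBl (a := a) al bc.
  by move=> s; apply: cvgMl; apply: cvgN; exact: h.
- move=> s; rewrite in_itv/= => /andP[_ sb].
  by apply: continuous_frac_kernel; exact: lt_le_trans bc.
- by move=> s _; exact: frac_kernel_ge0.
- move=> s; rewrite in_itv/= => /andP[_ sb].
  have sc : s < c by exact: lt_le_trans bc.
  have dp := is_derive_powRBl (1 - alpha) sc.
  have -> : F = (- (1 - alpha)^-1) \*: (fun s => (c - s) `^ (1 - alpha)).
    by apply/funext => x; rewrite /F /= /GRing.scale/= mulrC mulrN mulNr.
  apply: (is_derive_eq (is_deriveZ _ dp)).
  rewrite /GRing.scale/= /frac_kernel -powRN.
  rewrite (_ : 1 - alpha - 1 = - alpha); last by ring.
  by field; rewrite gt_eqF.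
Qed.

Lemma integrable_frac_kernel alpha a b c : 0 < alpha < 1 -> a < b -> b <= c ->
  mu.-integrable `]a, b[ (EFin \o frac_kernel alpha c).
Proof.
move=> al ab bc; apply/integrableP; split.
  apply/measurable_EFinP.
  apply: open_continuous_measurable_fun; first exact: interval_open.
  move=> s; rewrite inE/= in_itv/= => /andP[_ sb].
  by apply: continuous_frac_kernel; exact: lt_le_trans bc.
under eq_integral => s _ do rewrite /= (ger0_norm (frac_kernel_ge0 alpha c s)).
by rewrite integral_frac_kernel// ltry.
Qed.

Lemma Rintegral_frac_kernel alpha a b c : 0 < alpha < 1 -> a < b -> b <= c ->
  \int[mu]_(s in `]a, b[) frac_kernel alpha c s =
   ((c - a) `^ (1 - alpha) - (c - b) `^ (1 - alpha)) / (1 - alpha).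
Proof. by move=> al ab bc; rewrite /Rintegral integral_frac_kernel. Qed.

Lemma frac_kernel_le alpha c s t : 0 < alpha -> s <= t -> t < c ->
  frac_kernel alpha c s <= frac_kernel alpha c t.
Proof.
move=> al st tc; rewrite lef_pV2 ?posrE ?powR_gt0 ?subr_gt0//; last by lra.
by rewrite ge0_ler_powR ?nnegrE ?(ltW al)//; lra.
Qed.

(** The cells are open, but the grid points they omit form a null set. *)
Lemma Rintegral_itvoo_nat (f : R -> R) tau n : 0 < tau ->
  mu.-integrable `]0, n%:R * tau[ (EFin \o f) ->
  \int[mu]_(s in `]0, n%:R * tau[) f s =
  \sum_(0 <= j < n) \int[mu]_(s in grid_cell tau j) f s.
Proof.
move=> tau0; elim: n => [|n IH] fi.
  by rewrite big_geq// mul0r set_itv_ge ?Rintegral_set0// bnd_simp ltxx.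
have nSn : n%:R * tau < n.+1%:R * tau by rewrite ltr_pM2r// ltr_nat.
have n0 : 0 <= n%:R * tau by rewrite mulr_ge0// ltW.
have fi' : mu.-integrable `]0, n%:R * tau[ (EFin \o f).
  apply: integrableS fi => //; apply: subset_itvl; rewrite bnd_simp.
  exact: ltW.
rewrite big_nat_recr//= -IH// /grid_cell.
rewrite -(Rintegral_itvB (x := n%:R * tau) fi) ?bnd_simp//.
by rewrite (Rintegral_itv_bndo_bndc fi') subrKC.
Qed.

Section cell.
Variables (e k : R -> R) (a b D : R).
Hypotheses (ab : a < b) (eD : forall s, s \in `]a, b[ -> `|e s| <= D).
Hypotheses (ik : mu.-integrable `]a, b[ (EFin \o k))
  (ie : mu.-integrable `]a, b[ (EFin \o e))
  (iek : mu.-integrable `]a, b[ (EFin \o (fun s => e s * k s))).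

(** Meant for the last cell: k is unbounded there, but its integral is explicit. *)
Lemma normr_Rintegral_cell : {in `]a, b[, forall s, 0 <= k s} ->
  `|\int[mu]_(s in `]a, b[) (e s * k s)| <= D * \int[mu]_(s in `]a, b[) k s.
Proof.
move=> k0; rewrite (le_trans (le_normr_Rintegral _ iek))// -RintegralZl//.
apply: le_Rintegral => //.
- by have := integrable_norm iek; apply.
- exact: integrable_mulrl.
- by move=> s sab; rewrite normrM (ger0_norm (k0 s sab)) ler_wpM2r ?k0// eD.
Qed.

(* As e has mean zero, a constant can be subtracted from k. *)
Lemma normr_Rintegral_cell_mean0 (k0 k1 : R) :
    \int[mu]_(s in `]a, b[) e s = 0 -> {in `]a, b[, forall s, k0 <= k s <= k1} ->
  `|\int[mu]_(s in `]a, b[) (e s * k s)| <= D * ((k1 - k0) * (b - a)).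
Proof.
move=> e0 kk.
have ic (r : R) : mu.-integrable `]a, b[ (EFin \o cst r).
  apply: (@integrableS _ _ _ mu `[a, b]) => //; first exact: subset_itv_oo_cc.
  by apply: within_continuous_integrable; exact: within_continuous_cst.
have iek0 : mu.-integrable `]a, b[ (EFin \o (fun s => e s * k0)).
  exact: integrable_mulrr.
have -> : \int[mu]_(s in `]a, b[) (e s * k s) =
    \int[mu]_(s in `]a, b[) (e s * k s - e s * k0).
  by rewrite RintegralB// RintegralZr// e0 mul0r subr0.
have iB : mu.-integrable `]a, b[ (EFin \o (fun s => e s * k s - e s * k0)).
  exact: integrable_subr.
rewrite (le_trans (le_normr_Rintegral _ iB))//.
have -> : D * ((k1 - k0) * (b - a)) = \int[mu]_(s in `]a, b[) (D * (k1 - k0)).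
  have muE : mu `]a, b[%classic = (b - a)%:E by rewrite lebesgue_measure_itv/= lte_fin ab.
  by rewrite Rintegral_cst// [X in fine X]muE mulrA.
apply: le_Rintegral => //.
- by have := integrable_norm iB; apply.
- exact: (ic (D * (k1 - k0))).
move=> s sab; have /andP[h0 h1] := kk s sab.
rewrite -mulrBr normrM; apply: ler_pM => //; first exact: eD.
by rewrite ger0_norm ?subr_ge0// lerB.
Qed.

End cell.

End fractional_kernel.

(** * The error of the L1 scheme in terms of the oscillation of y' on the cells *)

Section L1_consistency.
Context {R : realType}.
Implicit Types (g y : R -> R) (alpha tau T B : R).
Local Notation mu := (@lebesgue_measure R).

(** Summation by parts trades nodal values for increments, which are tau times the slopes of the
    interpolant. *)
Lemma L1_derivativeE alpha tau y n : alpha < 1 ->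
  L1_derivative alpha tau y n.+1 = tau `^ (- alpha) / Gamma (2 - alpha) *
    \sum_(0 <= j < n.+1) L1_coef alpha (n - j) * (y (j.+1%:R * tau) - y (j%:R * tau)).
Proof.
move=> al1; rewrite /L1_derivative; congr (_ * _) => /=.
under [RHS]eq_bigr do rewrite mulrBr.
rewrite sumrB [X in _ = X - _]big_nat_recr//= subnn [X in _ = _ - X]big_nat_recl//= subn0 mul0r.
rewrite big_add1/=.
(* Here alpha < 1 matters: at alpha = 1 the convention 0^0 = 1 would give 0. *)
have -> : L1_coef alpha 0 = 1.
  by rewrite /L1_coef powR1 powR0 ?subr0// gt_eqF// subr_gt0.
under eq_bigr do rewrite subSS mulrBl.
rewrite sumrB mul1r.
under [X in _ - (X - _)]eq_bigr do rewrite -subnS.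
by ring.
Qed.

(* All cells but the last contribute a telescoping sum of differences of the
   kernel, which its last value tau `^ (- alpha) bounds. *)
Lemma L1_error alpha T tau y g n B : 0 < alpha < 1 -> 0 < tau -> (0 < n)%N ->
    n%:R * tau <= T ->
    {within `[0, T], continuous y} -> {within `[0, T], continuous g} ->
    {in `]0, T[, forall x : R, is_derive x 1 y (g x)} ->
    (forall j s t, (j < n)%N -> grid_cell tau j s -> grid_cell tau j t ->
      `|g s - g t| <= B) ->
  `|caputo alpha y (n%:R * tau) - L1_derivative alpha tau y n|
    <= `|Gamma (1 - alpha)|^-1 * (1 + (1 - alpha)^-1) * tau `^ (1 - alpha) * B.
Proof.
move=> al tau0; case: n => // n _ nT cy cg dy gB.
have /andP[al0 al1] := al; have al10 : 0 < 1 - alpha by rewrite subr_gt0.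
set c := n.+1%:R * tau.
pose t_ (j : nat) : R := j%:R * tau.
have tS j : t_ j.+1 = t_ j + tau by rewrite /t_ -natr1 mulrDl mul1r.
have tlt j : t_ j < t_ j.+1 by rewrite tS ltrDl.
have tle i j : (i <= j)%N -> t_ i <= t_ j by move=> ij; rewrite ler_pM2r// ler_nat.
have t0 j : 0 <= t_ j by rewrite mulr_ge0// ltW.
have jT j : (j <= n.+1)%N -> t_ j <= T by move=> /tle /le_trans; apply.
have cE : c = t_ n.+1 by [].
have c0 : 0 < c by rewrite cE (le_lt_trans (t0 n)).
have T0 : 0 < T by exact: lt_le_trans nT.
have sub_cell j : (j < n.+1)%N -> `[t_ j, t_ j.+1] `<=` `[0, T].
  move=> jn; apply: subset_itv; rewrite bnd_simp //; exact: jT.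
have sub_cello j : (j < n.+1)%N -> `]t_ j, t_ j.+1[ `<=` `]0, T[.
  move=> jn; apply: subset_itv; rewrite bnd_simp //; exact: jT.
have sub0c : `]0, c[ `<=` `]0, T[ by apply: subset_itvl; rewrite bnd_simp.
pose k := frac_kernel alpha c.
(* g is bounded on a compact segment, so g k inherits integrability from k. *)
have [M gM] : exists M, forall s, s \in `[0, T] -> `|g s| <= M.
  have [x xT xM] := EVT_max (ltW T0) (within_continuous_normr cg).
  by exists `|g x| => s; exact: xM.
have ik : mu.-integrable `]0, c[ (EFin \o k) by exact: integrable_frac_kernel.
have mg : measurable_fun `]0, c[ g.
  apply: (measurable_funS _ sub0c) => //.
  apply: open_continuous_measurable_fun; first exact: interval_open.
  by have /(continuous_within_itvP _ T0)[cg' _ _] := cg; apply/in_continuous_mksetP.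
have igk : mu.-integrable `]0, c[ (EFin \o (fun s => g s * k s)).
  have : mu.-integrable `]0, c[ (EFin \o (fun s => M * k s)) by exact: integrable_mulrl.
  apply: le_integrable => //.
    apply/measurable_EFinP/measurable_funM => //.
    by have /integrableP[/measurable_EFinP] := ik.
  move=> s sc; rewrite /= lee_fin !normrM ler_wpM2r//.
  rewrite (le_trans (gM s _)) ?ler_norm//.
  exact/subset_itv_oo_cc/sub0c.
have subc j : (j < n.+1)%N -> grid_cell tau j `<=` `]0, c[.
  by move=> jn; apply: subset_itv; rewrite bnd_simp ?t0// cE; exact: tle.
have mcell j : measurable (grid_cell tau j) by exact: measurable_itv.
have iS j (f : R -> R) : (j < n.+1)%N -> mu.-integrable `]0, c[ (EFin \o f) ->
    mu.-integrable (grid_cell tau j) (EFin \o f).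
  by move=> jn; apply: integrableS => //; [exact: measurable_itv|exact: subc].
have capE : caputo alpha y c = (Gamma (1 - alpha))^-1 *
    \sum_(0 <= j < n.+1) \int[mu]_(s in grid_cell tau j) (g s * k s).
  rewrite /caputo -Rintegral_itvoo_nat//; congr (_ * _); apply: eq_Rintegral => s.
  rewrite inE => /sub0c sT.
  by rewrite derive1E (derive_val (is_derive := dy s sT)).
pose m j := (y (t_ j.+1) - y (t_ j)) / tau.
(* The scheme is the Caputo derivative of the piecewise linear interpolant: [L1_coef] is the exact
   integral of k over a cell up to scaling, and the factor 1 / (1 - alpha) of that integral turns
   [Gamma (1 - alpha)] into [Gamma (2 - alpha)]. *)
have L1E : L1_derivative alpha tau y n.+1 = (Gamma (1 - alpha))^-1 *
    \sum_(0 <= j < n.+1) \int[mu]_(s in grid_cell tau j) (m j * k s).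
  rewrite L1_derivativeE// !mulr_sumr; apply: eq_big_nat => j /andP[_ jn].
  rewrite RintegralZl; [|exact: mcell|exact: iS].
  rewrite (Rintegral_frac_kernel al (tlt j)); last by rewrite cE; exact: (tle j.+1).
  have -> : c - t_ j = (n - j).+1%:R * tau.
    by rewrite cE /t_ -mulrBl -subSn// natrB// ltnW.
  have -> : c - t_ j.+1 = (n - j)%:R * tau.
    by rewrite cE /t_ -mulrBl -natrB// subSS.
  rewrite !powRM ?ler0n ?(ltW tau0)//.
  rewrite (_ : 2 - alpha = (1 - alpha) + 1); last by ring.
  rewrite GammaD1// invfM /L1_coef /m -/(t_ j.+1) -/(t_ j).
  rewrite (@powRB _ tau 1 alpha) ?(gt_eqF tau0) ?implybT// powRr1 ?(ltW tau0)// powRN.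
  have ta0 : tau `^ alpha != 0 by rewrite gt_eqF// powR_gt0.
  (* With the inverse as an atom, [field] only has to invert tau^alpha, 1 - alpha and tau. *)
  move: (Gamma _)^-1 => G.
  by field; rewrite ta0 (gt_eqF al10) gt_eqF.
pose e j s := g s - m j.
have Hi j : (j < n.+1)%N ->
    [/\ mu.-integrable (grid_cell tau j) (EFin \o g),
    mu.-integrable (grid_cell tau j) (EFin \o k) &
    mu.-integrable (grid_cell tau j) (EFin \o (fun s => g s * k s))].
  move=> jn; split; try exact: iS.
  apply: (@integrableS _ _ _ mu `[0, T]); [exact: measurable_itv|exact: mcell| |].
    by move=> s /(sub_cello _ jn); exact: subset_itv_oo_cc.
  exact: within_continuous_integrable.
have ic j r : (j < n.+1)%N -> mu.-integrable (grid_cell tau j) (EFin \o cst r).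
  move=> jn; apply: (@integrableS _ _ _ mu `[t_ j, t_ j.+1]).
  - exact: measurable_itv.
  - exact: mcell.
  - exact: subset_itv_oo_cc.
  - by apply: within_continuous_integrable; exact: within_continuous_cst.
have ie j : (j < n.+1)%N -> mu.-integrable (grid_cell tau j) (EFin \o e j).
  by move=> jn; have [ig _ _] := Hi j jn; apply: integrable_subr; [exact: mcell|exact: ig|exact: ic].
have ekE j s : e j s * k s = g s * k s - m j * k s by rewrite mulrBl.
have iek j : (j < n.+1)%N ->
    mu.-integrable (grid_cell tau j) (EFin \o (fun s => e j s * k s)).
  move=> jn; have [_ ik' igk'] := Hi j jn.
  under eq_fun do rewrite /= ekE.
  by apply: integrable_subr => //; [exact: mcell|apply: integrable_mulrl; [exact: mcell|]].
have muE j : mu (grid_cell tau j) = tau%:E.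
  by rewrite lebesgue_measure_itv/= lte_fin tlt -EFinB -/(t_ j.+1) tS addrAC subrr add0r.
have cyj j : (j < n.+1)%N -> {within `[t_ j, t_ j.+1], continuous y}.
  by move=> /sub_cell h; exact: continuous_subspaceW cy.
have dyj j : (j < n.+1)%N -> {in `]t_ j, t_ j.+1[, forall x : R, is_derive x 1 y (g x)}.
  by move=> /sub_cello h x /h; exact: dy.
have e0 j : (j < n.+1)%N -> \int[mu]_(s in grid_cell tau j) e j s = 0.
  move=> jn; have [ig _ _] := Hi j jn.
  rewrite RintegralB; [|exact: mcell|exact: ig|exact: (ic _ (m j))].
  rewrite Rintegral_cst; last exact: mcell.
  rewrite [X in fine X]muE /m divfK ?gt_eqF//.
  have cgj : {within `[t_ j, t_ j.+1], continuous g}.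
    exact: continuous_subspaceW (sub_cell _ jn) cg.
  rewrite -(@Rintegral_FTC2 _ _ g)//; last 2 first.
  - exact: cyj.
  - exact: dyj.
  rewrite Rintegral_itv_bndo_bndc// Rintegral_itv_obnd_cbnd ?subrr//.
  apply: (@integrableS _ _ _ mu `[t_ j, t_ j.+1]) => //.
    exact: subset_itv_oc_cc.
  exact: within_continuous_integrable.
(* By the mean value theorem the slope [m j] is a value g x with x in the same cell. *)
have eB j s : (j < n.+1)%N -> s \in `]t_ j, t_ j.+1[ -> `|e j s| <= B.
  move=> jn sj; have [x xj yE] := MVT (tlt j) (dyj j jn) (cyj j jn).
  by rewrite /e /m yE tS addrAC subrr add0r mulfK ?gt_eqF//; exact: gB jn sj xj.
have B0 : 0 <= B.
  apply: le_trans (normr_ge0 _) (eB n ((t_ n + t_ n.+1) / 2) _ _) => //.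
  by rewrite in_itv/= midf_lt//= midf_lt.
rewrite capE L1E -mulrBr normrM normfV -!mulrA ler_wpM2l ?invr_ge0//.
rewrite -sumrB.
have -> : \sum_(0 <= j < n.+1) (\int[mu]_(s in grid_cell tau j) (g s * k s) -
      \int[mu]_(s in grid_cell tau j) (m j * k s)) =
    \sum_(0 <= j < n.+1) \int[mu]_(s in grid_cell tau j) (e j s * k s).
  apply: eq_big_nat => j /andP[_ jn]; have [_ ik' igk'] := Hi j jn.
  rewrite -RintegralB; [|exact: mcell|exact: igk'|by apply: integrable_mulrl; [exact: mcell|]].
  by apply: eq_Rintegral => s _; rewrite ekE.
rewrite (le_trans (ler_norm_sum _ _ _))// big_nat_recr//=.
(* The summand 1 pays for the telescoping cells, (1 - alpha)^-1 for the last one. *)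
have -> : (1 + (1 - alpha)^-1) * (tau `^ (1 - alpha) * B) =
  B * tau * tau `^ (- alpha) + B * (tau `^ (1 - alpha) / (1 - alpha)).
  rewrite (@powRB _ tau 1 alpha) ?(gt_eqF tau0) ?implybT// powRr1 ?(ltW tau0)// powRN.
  by ring.
apply: lerD; last first.
  have [_ ik' igk'] := Hi n (ltnSn n).
  apply: (le_trans (normr_Rintegral_cell (D := B) _ ik' (iek n (ltnSn n)) _)).
  - by move=> s; exact: eB.
  - by move=> s _; exact: frac_kernel_ge0.
  rewrite (Rintegral_frac_kernel al (tlt n))//.
  by rewrite cE subrr powR0 ?gt_eqF// subr0 [X in X - t_ n]tS addrAC subrr add0r.
have hk j : (j < n)%N -> `|\int[mu]_(s in grid_cell tau j) (e j s * k s)| <=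
    B * tau * (k (t_ j.+1) - k (t_ j)).
  move=> jn; have jn1 := ltnW jn; have [_ ik' igk'] := Hi j jn1.
  have tj : t_ j.+1 < c by rewrite cE (le_lt_trans (tle _ _ jn)).
  apply: (le_trans (normr_Rintegral_cell_mean0 (D := B) (k0 := k (t_ j)) (k1 := k (t_ j.+1))
    (tlt j) _ (ie _ jn1) (iek _ jn1) (e0 _ jn1) _)).
  - by move=> s; exact: eB.
  - move=> s; rewrite in_itv/= => /andP[ts st].
    apply/andP; split; apply: frac_kernel_le => //; first exact: ltW.
    + exact: lt_trans tj.
    + exact: ltW.
  - by rewrite tS addrAC subrr add0r [_ * tau]mulrC mulrA.
apply: (@le_trans _ _ (\sum_(0 <= j < n) (B * tau * (k (t_ j.+1) - k (t_ j))))).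
  by apply: ler_sum_nat => j /andP[_ jn]; exact: hk.
rewrite -mulr_sumr telescope_sumr// ler_wpM2l ?mulr_ge0 ?(ltW tau0)//.
rewrite (_ : tau `^ (- alpha) = k (t_ n)).
  by rewrite lerBlDr lerDl frac_kernel_ge0.
by rewrite /k /frac_kernel powRN cE tS addrAC subrr add0r.
Qed.

End L1_consistency.

(** * Negative powers of the weight, the quantity [Lambda] and the A_p condition *)

Section weights_lemmas.
Context {R : realType}.
Implicit Types (T p q r tau : R) (w v : R -> R) (D : set R).
Local Notation mu := (@lebesgue_measure R).
Local Open Scope ereal_scope.

Lemma neg_powR_ge0 w r x : 0 <= neg_powR w r x.
Proof. exact: poweR_ge0. Qed.

Lemma neg_powR_gt0 w r x : (0 < w x)%R -> neg_powR w r x = (w x `^ (- r))%:E.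
Proof.
move=> wx; rewrite /neg_powR inver gt_eqF// poweR_EFin.
by rewrite -powR_inv1 ?(ltW wx)// -powRrM mulN1r.
Qed.

Lemma neg_powR_eq0 w r x : r != 0%R -> w x = 0%R -> neg_powR w r x = +oo.
Proof. by move=> r0 wx; rewrite /neg_powR wx inver eqxx poweRyr. Qed.

Lemma measurable_neg_powR D w r : r != 0%R -> measurable D ->
  {in D, forall x, (0 <= w x)%R} -> measurable_fun D w ->
  measurable_fun D (neg_powR w r).
Proof.
move=> r0 mD w0 mw.
pose h (u : R) : \bar R := if u == 0%R then +oo else (u `^ (- r))%:E.
apply: (@eq_measurable_fun _ _ _ _ _ (h \o w)).
  move=> x /w0; rewrite /h /= le_eqVlt => /predU1P[wx|wx].
    by rewrite -wx eqxx neg_powR_eq0.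
  by rewrite gt_eqF// neg_powR_gt0.
apply: (measurableT_comp _ mw); apply: measurable_fun_ifT => //.
  exact: measurable_fun_eqr.
by apply/measurable_EFinP; exact: measurable_powR.
Qed.

(** These identities match W_j, an L^q norm of w^(-1/p), with the integral of w^(-1/(p-1)) that the
    A_p condition controls. *)
Lemma conjugate_exponents p q : (1 < p)%R -> (p^-1 + q^-1 = 1)%R ->
  [/\ (0 < q)%R, (p^-1 * q = (p - 1)^-1)%R & (q^-1 = (p - 1) / p)%R].
Proof.
move=> p1 pq; have p0 : (0 < p)%R by exact: lt_trans p1.
have qE : (q^-1 = (p - 1) / p)%R.
  by rewrite mulrBl divff ?gt_eqF// mul1r -pq addrAC subrr add0r.
have q0 : (0 < q)%R by rewrite -invr_gt0 qE divr_gt0// subr_gt0.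
split => //; rewrite -[q in LHS]invrK qE; field.
by rewrite !gt_eqF// subr_gt0.
Qed.

Lemma cell_norm_integral p q w tau j : (1 < p)%R -> (p^-1 + q^-1 = 1)%R ->
  cell_norm p q w tau j =
  (\int[mu]_(x in grid_cell tau j) neg_powR w (p - 1)^-1 x) `^ q^-1.
Proof.
move=> p1 pq; have [q0 pqE _] := conjugate_exponents p1 pq.
rewrite /cell_norm unlock /Lnorm; congr (_ `^ _).
rewrite [RHS]integral_mkcond; apply: eq_integral => x _.
rewrite !patchE; case: ifPn => _; last by rewrite abse0 poweR0r// gt_eqF.
by rewrite gee0_abs ?neg_powR_ge0// /neg_powR -poweRrM pqE.
Qed.

Lemma Lambda_term p q w tau j : (0 < tau)%R -> (1 < p)%R -> (p^-1 + q^-1 = 1)%R ->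
  (tau `^ (- q^-1))%:E * cell_norm p q w tau j =
  ((tau^-1)%:E * \int[mu]_(s in grid_cell tau j) neg_powR w (p - 1)^-1 s)
    `^ ((p - 1) / p).
Proof.
move=> tau0 p1 pq; have [q0 _ qE] := conjugate_exponents p1 pq.
rewrite cell_norm_integral// -qE poweRM ?lee_fin ?invr_ge0 ?(ltW tau0)//; last first.
  by apply: integral_ge0 => x _; exact: neg_powR_ge0.
by congr (_ * _); rewrite poweR_EFin -[(tau^-1)%R]powR_inv1 ?(ltW tau0)// -powRrM mulN1r.
Qed.

(* With J = ]0, T[ and the convention 0 * oo = oo, the second factor of the A_p
   product is finite. *)
Lemma Ap_integral_lty T p w : (0 < T)%R -> (1 < p)%R -> muckenhoupt T p w ->
  \int[mu]_(x in `]0%R, T[) neg_powR w (p - 1)^-1 x < +oo.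
Proof.
move=> T0 p1 [[wp _] Ap]; set I := integral _ _ _.
have I0 : 0 <= I by apply: integral_ge0 => x _; exact: neg_powR_ge0.
rewrite ltey; apply/eqP => Iy.
have muT : mu `]0%R, T[%classic = T%:E.
  by rewrite lebesgue_measure_itv/= lte_fin T0 sube0.
have w0 : 0 <= mean (EFin \o w) `]0%R, T[.
  rewrite /mean muT mule_ge0 ?inve_ge0 ?lee_fin ?(ltW T0)//.
  by apply: integral_ge0 => x xT; rewrite lee_fin; apply: wp.
have ny : mean (neg_powR w (p - 1)^-1) `]0%R, T[ `^ (p - 1) = +oo.
  rewrite /mean muT -/I Iy inver gt_eqF// gt0_muley ?lte_fin ?invr_gt0//.
  by rewrite poweRyr// subr_eq0 gt_eqF.
move: Ap; rewrite ltNge => /negP; apply.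
apply: ereal_sup_ubound; exists `]0%R, T[%classic.
  by split => //; [exact: interval_is_interval|rewrite muT lte_fin].
(* The product is +oo in both cases: by the convention if the mean of w is 0, as an ordinary product
   if it is positive. *)
rewrite ny /mule_0y eqxx andbT; case: eqP => [//|/eqP m0] /=.
by rewrite andbF gt0_muley// lt0e m0.
Qed.

End weights_lemmas.

(** * Hoelder's inequality with a weight *)

Section weighted_hoelder.
Context {R : realType}.
Implicit Types (T p q r tau : R) (w v y : R -> R) (D : set R).
Local Notation mu := (@lebesgue_measure R).
Local Open Scope ereal_scope.

Lemma le_poweR r (x y : \bar R) : (0 <= r)%R -> 0 <= x -> x <= y -> x `^ r <= y `^ r.
Proof.
move=> r0 x0 xy; apply: gt0_ler_poweR => //; rewrite in_itv/= leey andbT//.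
exact: le_trans xy.
Qed.

(** The splitting |v| = (|v| w^(1/p)) w^(-1/p) is valid where w > 0, that is almost everywhere since
    the last integral is finite. *)
Lemma hoelder_weight p q D w v : (1 < p)%R -> (p^-1 + q^-1 = 1)%R ->
    measurable D -> measurable_fun D w -> measurable_fun D v ->
    {in D, forall x, (0 <= w x)%R} ->
    \int[mu]_(x in D) neg_powR w (p - 1)^-1 x < +oo ->
  \int[mu]_(x in D) `|v x|%:E <=
  (\int[mu]_(x in D) (`|v x| `^ p * w x)%:E) `^ p^-1 *
  (\int[mu]_(x in D) neg_powR w (p - 1)^-1 x) `^ q^-1.
Proof.
move=> p1 pq mD mw mv w0 wfin.
have p0 : (0 < p)%R by exact: lt_trans p1.
have pp0 : (0 < p - 1)%R by rewrite subr_gt0.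
have r0 : ((p - 1)^-1 != 0)%R by rewrite invr_neq0// gt_eqF.
have [q0 pqE _] := conjugate_exponents p1 pq.
have wD x : D x -> (0 <= w x)%R by move=> Dx; apply: w0; rewrite inE.
have mneg : measurable_fun D (neg_powR w (p - 1)^-1).
  exact: measurable_neg_powR.
(* Where w vanishes, neg_powR is infinite; this is a null set. *)
have w_gt0 : \forall x \ae mu, D x -> (0 < w x)%R.
  have iw : mu.-integrable D (neg_powR w (p - 1)^-1).
    apply/integrableP; split => //.
    by under eq_integral => x _ do rewrite gee0_abs ?neg_powR_ge0//.
  have := integrable_ae (mu := mu) mD iw; apply: filterS => x + Dx => /(_ Dx).
  have := wD _ Dx; rewrite le_eqVlt => /predU1P[wx|//].
  by rewrite neg_powR_eq0.
have mpow r : measurable_fun D (fun x => w x `^ r)%R.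
  exact: (@measurableT_comp _ _ _ _ _ _ (@powR R ^~ r) _ w (@measurable_powR R r) mw).
pose f := (fun x => `|v x| * w x `^ p^-1)%R \_ D.
pose h := (fun x => w x `^ (- p^-1))%R \_ D.
have mf : measurable_fun [set: R] f.
  apply/(measurable_restrictT _ _).1 => //.
  apply: measurable_funM; first exact: measurableT_comp.
  exact: (mpow _).
have mh : measurable_fun [set: R] h.
  exact/(measurable_restrictT _ _).1.
have := hoelder mu mf mh p0 q0 pq.
have -> : 'N[mu]_p%:E[EFin \o f] = (\int[mu]_(x in D) (`|v x| `^ p * w x)%:E) `^ p^-1.
  rewrite unlock /Lnorm; congr (_ `^ _).
  rewrite [RHS]integral_mkcond; apply: eq_integral => x _.
  rewrite /f /= !patchE; case: ifPn => [|_]; last by rewrite normr0 powR0// gt_eqF.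
  rewrite inE => Dx; rewrite ger0_norm ?mulr_ge0 ?powR_ge0//.
  rewrite powRM ?powR_ge0// -[((w x `^ _) `^ _)%R]powRrM mulVf ?gt_eqF// powRr1//.
  exact: wD.
(* Only an inequality pointwise: where w vanishes, the real power in [h] is 0 while [neg_powR] is
   +oo. *)
have hN : 'N[mu]_q%:E[EFin \o h] <= (\int[mu]_(x in D) neg_powR w (p - 1)^-1 x) `^ q^-1.
  rewrite unlock /Lnorm; apply: le_poweR.
  - by rewrite invr_ge0 ltW.
  - by apply: integral_ge0 => x _; exact: poweR_ge0.
  rewrite [leRHS]integral_mkcond; apply: ge0_le_integral => //.
  - by move=> x _; exact: poweR_ge0.
  - apply: (measurableT_comp (measurable_poweR _)).
    by apply: measurableT_comp => //; exact/measurable_EFinP.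
  - exact/(measurable_restrictT _ _).1.
  move=> x _; rewrite /h /= !patchE; case: ifPn => [|_]; last first.
    by rewrite normr0 powR0// gt_eqF.
  rewrite inE => Dx; rewrite ger0_norm ?powR_ge0//.
  have := wD _ Dx; rewrite le_eqVlt => /predU1P[wx|wx].
    by rewrite neg_powR_eq0// leey.
  by rewrite neg_powR_gt0// lee_fin -powRrM mulNr pqE.
have <- : 'N[mu]_1[EFin \o (f \* h)%R] = \int[mu]_(x in D) `|v x|%:E.
  rewrite Lnorm1 [RHS]integral_mkcond; apply: ae_eq_integral => //.
  - by apply: measurableT_comp => //; apply/measurable_EFinP/measurable_funM.
  - apply/(measurable_restrictT _ _).1 => //.
    by apply/measurable_EFinP; exact: measurableT_comp.
  have aeF : Filter (almost_everywhere mu) by exact: ae_filter_ringOfSetsType.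
  apply: (@filterS _ _ aeF _ _ _ w_gt0) => x + _; rewrite /f /h /= !patchE.
  case: ifPn => [|_ _]; last by rewrite mulr0 normr0.
  rewrite inE => Dx /(_ Dx) wx.
  by rewrite powRN mulfK ?normr_id// gt_eqF// powR_gt0.
move=> /le_trans; apply; apply: lee_wpmul2l => //.
exact: poweR_ge0.
Qed.

End weighted_hoelder.

(** * Finiteness of [Lambda] and of the norm, and the oscillation of y' on a cell *)

Section sobolev_bounds.
Context {R : realType}.
Implicit Types (T p q tau : R) (w v y : R -> R) (D : set R) (s k j N : nat).
Local Notation mu := (@lebesgue_measure R).
Local Open Scope ereal_scope.

Lemma is_weight_ge0 T w x : is_weight T w -> `]0%R, T[%classic x -> (0 <= w x)%R.
Proof. by move=> [w0 _]; exact: w0. Qed.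

Lemma is_weight_measurable T w : is_weight T w -> measurable_fun `]0%R, T[ w.
Proof. by move=> [_ []]. Qed.

Lemma measurable_sobolev_integrand T p w v : is_weight T w ->
  measurable_fun `]0%R, T[ v ->
  measurable_fun `]0%R, T[ (fun t => (`|v t| `^ p * w t)%R).
Proof.
move=> /is_weight_measurable mw mv; apply: measurable_funM => //.
have mn : measurable_fun `]0%R, T[ (fun t => `|v t|%R) by exact: measurableT_comp.
exact: (@measurableT_comp _ _ _ _ _ _ (@powR R ^~ p) _ _ (@measurable_powR R p) mn).
Qed.

Lemma sobolev_norm_lty T s p w y : (0 < p)%R -> is_weight T w -> sobolev T s p w y ->
  sobolev_norm T s p w y < +oo.
Proof.
move=> p0 ww sy; apply: poweR_lty.
under eq_integral do rewrite mulr_suml -sumEFin.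
rewrite (@ge0_integral_sum _ _ _ mu _ _ _ (fun (k : 'I_s.+1) t =>
  (`|weak_derivative T k y t| `^ p * w t)%:E)).
- apply: lte_sum_pinfty => k _.
  have [_ [_ h]] := sy k (ltn_ord k). exact: h.
- exact: measurable_itv.
- move=> k; apply/measurable_EFinP; have [_ [mk _]] := sy k (ltn_ord k).
  exact: (measurable_sobolev_integrand p ww mk).
- move=> k x xT; rewrite lee_fin mulr_ge0 ?powR_ge0//.
  exact: is_weight_ge0 xT.
Qed.

Lemma le_sobolev_norm T s p w y k D : (0 < p)%R -> is_weight T w ->
    sobolev T s p w y -> (k <= s)%N -> measurable D -> D `<=` `]0%R, T[ ->
  (\int[mu]_(x in D) (`|weak_derivative T k y x| `^ p * w x)%:E) `^ p^-1
  <= sobolev_norm T s p w y.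
Proof.
move=> p0 ww sy ks mD DT.
have w0 x : `]0%R, T[%classic x -> (0 <= w x)%R by exact: is_weight_ge0.
have mk i : (i <= s)%N -> measurable_fun `]0%R, T[
    (fun t => (`|weak_derivative T i y t| `^ p * w t)%R).
  by move=> /sy[_ [mi _]]; exact: (measurable_sobolev_integrand p ww mi).
apply: le_poweR.
- by rewrite invr_ge0 ltW.
- by apply: integral_ge0 => x /DT xT; rewrite lee_fin mulr_ge0 ?powR_ge0 ?w0.
apply: (@le_trans _ _ (\int[mu]_(x in `]0%R, T[) (`|weak_derivative T k y x| `^ p * w x)%:E)).
  apply: ge0_subset_integral; [exact: mD|exact: measurable_itv| | |exact: DT].
  - by apply/measurable_EFinP; exact: mk.
  - by move=> x xT; rewrite lee_fin mulr_ge0 ?powR_ge0 ?w0.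
apply: ge0_le_integral => //.
- by move=> x xT; rewrite lee_fin mulr_ge0 ?powR_ge0 ?w0.
- by apply/measurable_EFinP; exact: mk.
- apply/measurable_EFinP.
  apply: (eq_measurable_fun (fun t =>
      \sum_(i < s.+1) `|weak_derivative T i y t| `^ p * w t)%R).
    by move=> t _; rewrite mulr_suml.
  by apply: measurable_sum => i; exact: (mk i (ltn_ord i)).
- move=> x xT; rewrite lee_fin ler_wpM2r ?w0//.
  rewrite (bigD1 (inord k))//= inordK ?ltnS// lerDl.
  by apply: sumr_ge0 => i _; exact: powR_ge0.
Qed.

Lemma grid_cell_sub T N j : (0 < T)%R -> (j < N)%N ->
  grid_cell (T / N%:R) j `<=` `]0%R, T[.
Proof.
move=> T0 jN; have N0 : (0 < N%:R :> R)%R by rewrite ltr0n (leq_trans _ jN).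
apply: subset_itv; rewrite bnd_simp.
  by rewrite mulr_ge0// divr_ge0// ltW.
rewrite mulrCA ger_pMr// ler_pdivrMr// mul1r.
by rewrite ler_nat.
Qed.

(** Every cell integral is at most the one over ]0, T[. The resulting bound grows with N, but it
    only serves to pass to real numbers. *)
Lemma Lambda_lty T p q w N : (0 < T)%R -> (1 < p)%R -> (p^-1 + q^-1 = 1)%R ->
  muckenhoupt T p w -> (0 < N)%N -> Lambda p q w (T / N%:R) N < +oo.
Proof.
move=> T0 p1 pq Ap N0.
have p0 : (0 < p)%R by exact: lt_trans p1.
have pp0 : (0 < p - 1)%R by rewrite subr_gt0.
have tau0 : (0 < T / N%:R)%R by rewrite divr_gt0// ltr0n.
have [ww _] := Ap.
apply: (@le_lt_trans _ _ (((T / N%:R)^-1%:E *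
    \int[mu]_(s in `]0%R, T[) neg_powR w (p - 1)^-1 s) `^ ((p - 1) / p))).
  apply: ge_ereal_sup => _ [j /= jN <-]; rewrite Lambda_term//.
  apply: le_poweR; first by rewrite divr_ge0// ltW.
    rewrite mule_ge0 ?lee_fin ?invr_ge0 ?(ltW tau0)//.
    by apply: integral_ge0 => x _; exact: neg_powR_ge0.
  apply: lee_wpmul2l; first by rewrite lee_fin invr_ge0 ltW.
  apply: ge0_subset_integral; [exact: measurable_itv|exact: measurable_itv| | |].
  - apply: measurable_neg_powR; [by rewrite invr_neq0// gt_eqF|exact: measurable_itv| |].
      by move=> x; rewrite inE; exact: is_weight_ge0.
    exact: is_weight_measurable.
  - by move=> x _; exact: neg_powR_ge0.
  - exact: grid_cell_sub.
apply: poweR_lty; apply: lte_mul_pinfty; rewrite ?lee_fin ?invr_ge0 ?(ltW tau0)//.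
exact: Ap_integral_lty.
Qed.

Lemma cell_norm_le_Lambda p q w tau N j : (0 < tau)%R -> (j < N)%N ->
  cell_norm p q w tau j <= (tau `^ q^-1)%:E * Lambda p q w tau N.
Proof.
move=> tau0 jN.
have : (tau `^ (- q^-1))%:E * cell_norm p q w tau j <= Lambda p q w tau N.
  by apply: ereal_sup_ubound; exists j.
have t0 : (0 < tau `^ q^-1)%R by rewrite powR_gt0.
rewrite powRN => h; rewrite -lee_pdivrMl//.
Qed.

(** The integral of |y''| over [x, z] is enlarged to the cell before Hoelder's inequality, so that
    one bound serves all pairs of points and, through the supremum in [Lambda], all cells. *)
Lemma cell_oscillation T p q w y (g : R -> R) N j (x z : R) :
    (0 < T)%R -> (1 < p)%R -> (p^-1 + q^-1 = 1)%R ->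
    muckenhoupt T p w -> sobolev T 2 p w y ->
    {within `[0%R, T], continuous g} ->
    {in `]0%R, T[, forall x : R, is_derive x 1%R y (g x)} -> (j < N)%N ->
    grid_cell (T / N%:R) j x -> grid_cell (T / N%:R) j z ->
  `|g x - g z|%:E <= ((T / N%:R) `^ q^-1)%:E * Lambda p q w (T / N%:R) N *
                     sobolev_norm T 2 p w y.
Proof.
move=> T0 p1 pq Ap sy cg dy jN.
have p0 : (0 < p)%R by exact: lt_trans p1.
have pp0 : (0 < p - 1)%R by rewrite subr_gt0.
have N0 : (0 < N)%N by exact: leq_ltn_trans jN.
have tau0 : (0 < T / N%:R)%R by rewrite divr_gt0// ltr0n.
have [ww _] := Ap.
set tau := (T / N%:R)%R in tau0 *.
have cT : grid_cell tau j `<=` `]0%R, T[ by exact: grid_cell_sub.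
wlog xz : x z / (x <= z)%R.
  move=> H xc zc; have [xz|/ltW zx] := leP x z; first exact: H.
  by rewrite distrC; exact: H.
move=> xc zc.
have [mv _] : Lp_weighted T p w (weak_derivative T 2 y) by have [] := sy 2%N (leqnn _).
set v := weak_derivative T 2 y in mv *.
have wv : is_weak_derivative T 2 y v.
  (* [get] returns a genuine weak derivative because [sobolev] asserts that one exists. *)
  by have [[h hy] _] := sy 2%N (leqnn _); apply: (getPex (ex_intro _ h hy)).
have mcell : measurable (grid_cell tau j) by exact: measurable_itv.
have Iv : \int[mu]_(s in grid_cell tau j) `|v s|%:E <=
    (tau `^ q^-1)%:E * Lambda p q w tau N * sobolev_norm T 2 p w y.
  apply: le_trans (hoelder_weight (w := w) p1 pq mcell _ _ _ _) _.
  - by apply: (measurable_funS _ cT); [exact: measurable_itv|exact: is_weight_measurable].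
  - by apply: (measurable_funS _ cT); [exact: measurable_itv|exact: mv].
  - by move=> s; rewrite inE => /cT; exact: is_weight_ge0.
  - apply: le_lt_trans (Ap_integral_lty T0 p1 Ap).
    apply: ge0_subset_integral; [exact: measurable_itv|exact: measurable_itv| | |exact: cT].
    + apply: measurable_neg_powR; [by rewrite invr_neq0// gt_eqF|exact: measurable_itv| |].
        by move=> s; rewrite inE; exact: is_weight_ge0.
      exact: is_weight_measurable.
    + by move=> s _; exact: neg_powR_ge0.
  rewrite -cell_norm_integral// muleC; apply: lee_pmul.
  - exact: Lnorm_ge0.
  - exact: poweR_ge0.
  - exact: cell_norm_le_Lambda.
  - exact: le_sobolev_norm.
apply: le_trans Iv.
have [->|x_neq] := eqVneq x z.
  by rewrite subrr normr0; apply: integral_ge0 => s _; rewrite lee_fin.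
have xltz : (x < z)%R by rewrite lt_neqAle x_neq.
have /cT := xc; rewrite /= in_itv/= => /andP[x0 _].
have /cT := zc; rewrite /= in_itv/= => /andP[_ zT].
have iv : mu.-integrable `[x, z] (EFin \o v).
  by apply: locally_integrable_segment x0 zT _; have [_ []] := wv.
have := weak_derivative2_dist cg dy wv x0 xltz zT.
rewrite distrC -lee_fin => /le_trans; apply.
rewrite /Rintegral fineK; last first.
  apply: integrable_fin_num; first exact: measurable_itv.
  by have := integrable_norm iv; apply.
apply: ge0_subset_integral; [exact: measurable_itv|exact: mcell| | |].
- apply/measurable_EFinP; apply: measurableT_comp => //.
  by apply: (measurable_funS _ cT); [exact: measurable_itv|exact: mv].
- by move=> s _; rewrite lee_fin.
- move=> s; move: xc zc; rewrite /grid_cell /= !in_itv/=.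
  move=> /andP[a1 a2] /andP[b1 b2] /andP[s1 s2].
  by rewrite (lt_le_trans a1)// (le_lt_trans s2).
Qed.

End sobolev_bounds.


Theorem theorem1 (R : realType) (alpha p q T : R) (w : R -> R)
    (halpha : 0 < alpha < 1) (hp : 1 < p) (hpq : p^-1 + q^-1 = 1)
    (hT : 0 < T) (hw : muckenhoupt T p w) :
  (forall N : nat, (1 <= N)%N ->
    let tau := T / N%:R in
    Lambda p q w tau N =
    ereal_sup [set ((tau^-1)%:E *
                    \int[lebesgue_measure]_(s in grid_cell tau j)
                      neg_powR w (p - 1)^-1 s) `^ ((p - 1) / p) | j in `I_N]%E)
  /\
  exists2 C : R, 0 < C &
    forall y : R -> R, sobolev T 2 p w y -> C1_itv 0 T y ->
    forall N : nat, (1 <= N)%N ->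
    let tau := T / N%:R in
    forall n : nat, (1 <= n <= N)%N ->
      (`|caputo alpha y (n%:R * tau) - L1_derivative alpha tau y n|%:E
       <= (C * tau `^ (2 - alpha - p^-1))%:E * Lambda p q w tau N
          * sobolev_norm T 2 p w y)%E.
Proof.
have p0 : 0 < p by exact: lt_trans hp.
have tau_gt0 N : (1 <= N)%N -> 0 < T / N%:R by move=> N1; rewrite divr_gt0// ltr0n.
split.
  move=> N N1 tau; rewrite /Lambda; congr ereal_sup; apply: eq_imagel => j _.
  by apply: Lambda_term => //; exact: tau_gt0.
have /andP[al0 al1] := halpha.
pose K := `|Gamma (1 - alpha)|^-1 * (1 + (1 - alpha)^-1).
have K0 : 0 <= K by rewrite mulr_ge0 ?invr_ge0// addr_ge0 ?invr_ge0// subr_ge0 ltW.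
(* K is known to be nonnegative; adding 1 makes the constant positive. *)
exists (K + 1); first by rewrite ltr_wpDl.
move=> y sy [cy [g cg dy]] N N1 tau n /andP[n0 nN].
have tau0 : 0 < tau by exact: tau_gt0.
have [ww _] := hw.
set L := Lambda p q w tau N; set S := sobolev_norm T 2 p w y.
have L0 : (0 <= L)%E.
  apply: ereal_sup_ge; exists ((tau `^ (- q^-1))%:E * cell_norm p q w tau 0)%E.
    by exists 0%N.
  by rewrite mule_ge0 ?lee_fin ?powR_ge0// Lnorm_ge0.
have S0 : (0 <= S)%E by exact: poweR_ge0.
have Lfin : L \is a fin_num by rewrite ge0_fin_numE// Lambda_lty.
have Sfin : S \is a fin_num by rewrite ge0_fin_numE// sobolev_norm_lty.
pose B := tau `^ q^-1 * fine L * fine S.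
have B0 : 0 <= B by rewrite !mulr_ge0 ?powR_ge0 ?fine_ge0.
have osc j s t : (j < n)%N -> grid_cell tau j s -> grid_cell tau j t -> `|g s - g t| <= B.
  move=> jn js jt; rewrite -lee_fin !EFinM !fineK//.
  exact: (cell_oscillation hT hp hpq hw sy cg dy (leq_trans jn nN) js jt).
have nT : n%:R * tau <= T.
  by rewrite mulrCA ger_pMr// ler_pdivrMr ?ltr0n// mul1r ler_nat.
have := L1_error halpha tau0 n0 nT cy cg dy osc.
rewrite -lee_fin => /le_trans; apply.
rewrite -[L]fineK// -[S]fineK// -!EFinM lee_fin -/K.
(* By 1/q = 1 - 1/p, the power splits into the kernel factor and the one inside [B]. *)
have -> : tau `^ (2 - alpha - p^-1) = tau `^ (1 - alpha) * tau `^ q^-1.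
  rewrite -powRD ?(gt_eqF tau0) ?implybT//; congr (_ `^ _).
  have -> : q^-1 = 1 - p^-1 by rewrite -hpq addrAC subrr add0r.
  by ring.
rewrite [leRHS](_ : _ = (K + 1) * tau `^ (1 - alpha) * B); last by rewrite /B; ring.
by rewrite ler_wpM2r// ler_wpM2r ?powR_ge0// lerDl.
Qed.
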